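(* Let $d\ge 2$, let $\Gamma\in\mathcal{D}^d$, and let $\mathbf{Y}$ be a Hüsler–Reiss random vector (multivariate Pareto) with parameter matrix $\Gamma$. Let $i,j\in[d]$ be distinct and let $C\subseteq[d]\setminus\{i,j\}$ be non-empty. Then $$Y_i\perp_e Y_j\mid \mathbf{Y}_C \iff \det\bigl(\operatorname{CM}(\Gamma)_{iC(d+1),\,jC(d+1)}\bigr)=0 .$$
   Context: Notation: $[d]=\{1,\dots,d\}$; $\mathbf{1}$ is the all-ones vector; $\mathcal{H}^{d-1}=\{\mathbf{x}\in\mathbb{R}^d:\mathbf{x}^T\mathbf{1}=0\}$; $\mathbb{S}^d_0$ is the space of symmetric real $d\times d$ matrices with zero diagonal; $\mathcal{D}^d=\{\Gamma\in\mathbb{S}^d_0:\mathbf{x}^T\Gamma\mathbf{x}<0\text{ for all }\mathbf{x}\in\mathcal{H}^{d-1}\setminus\{\mathbf{0}\}\}$. Cayley–Menger matrix: $\operatorname{CM}(\Gamma)=\begin{pmatrix}-\Gamma/2&\mathbf{1}\\-\mathbf{1}^T&0\end{pmatrix}\in\mathbb{R}^{(d+1)\times(d+1)}$. $\operatorname{CM}(\Gamma)_{iC(d+1),jC(d+1)}$ is the submatrix with rows indexed by $\{i\}\cup C\cup\{d+1\}$ and columns indexed by $\{j\}\cup C\cup\{d+1\}$. Hüsler–Reiss vector: for $k\in[d]$ let $\Sigma^{(k)}=\tfrac12(\Gamma_{ik}+\Gamma_{jk}-\Gamma_{ij})_{i,j\ne k}$, a positive definite $(d-1)\times(d-1)$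 matrix with rows and columns indexed by $[d]\setminus\{k\}$. The Hüsler–Reiss multivariate Pareto vector $\mathbf{Y}$ with parameter $\Gamma$ is the random vector supported on $\mathcal{L}=\{\mathbf{x}\in\mathbb{R}^d:\max_i x_i>0\}$ such that for every $k\in[d]$ the conditioned vector $\mathbf{Y}^k:=\mathbf{Y}\mid\{Y_k>0\}$ satisfies $\mathbf{Y}^k\stackrel{d}{=}E\,\mathbf{1}+\mathbf{W}^k$, where $E$ is standard exponential, independent of $\mathbf{W}^k$, $W^k_k=0$, and $\mathbf{W}^k_{\setminus k}=(W^k_i)_{i\ne k}$ is multivariate Gaussian with mean $-\tfrac12\operatorname{diag}(\Sigma^{(k)})$ and covariance $\Sigma^{(k)}$. Extremal conditional independence: for disjoint $A,B,C\subset[d]$, write $\mathbf{Y}_A\perp_e\mathbf{Y}_B\mid\mathbf{Y}_C$ if for all $k\in A\cup B\cup C$ the ordinary conditional independence $\mathbf{Y}^k_A\perp\!\!\!\perp\mathbf{Y}^k_B\mid\mathbf{Y}^k_C$ holds, where $\mathbf{Y}^k_A$ denotes the subvector of $\mathbf{Y}^k$ indexed by $A$. (That is, extremal conditional independence is understood within the extremal marginal of $\mathbf{Y}$ on $A\cup B\cup C$, namely the subvector of $\mathbf{Y}$ conditioned on exceeding zero in at least one coordinate indexed by $A\cup B\cup C$.) *)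

(* Defs.v *)
From HB Require Import structures.
From mathcomp Require Import all_boot all_order all_algebra.
From mathcomp Require Import all_classical all_reals all_analysis.

Set Implicit Arguments.
Unset Strict Implicit.
Unset Printing Implicit Defensive.

Import Order.TTheory GRing.Theory Num.Theory.
Import numFieldNormedType.Exports.

Local Open Scope classical_set_scope.
Local Open Scope ring_scope.

(* Coordinates 1, ..., d are represented by 'I_d, vectors of R^d in
   measure-theoretic positions by d.-tuple R (which carries the product Borel
   sigma-algebra), and vectors in linear algebra by 'cV[R]_d. *)

Section matrices.
Context {R : realType}.

Definition hyperplane d (x : 'cV[R]_d) : Prop :=
  x^T *m const_mx 1 = 0 :> 'M[R]_1.

(* The set D^d of parameter matrices. *)
Definition HR_parameter d (G : 'M[R]_d) : Prop :=
  [/\ G^T = G, forall i, G i i = 0 &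
      forall x : 'cV[R]_d, hyperplane x -> x != 0 ->
        (x^T *m G *m x) 0 0 < 0].

(* The extra last index d+1 is rshift d ord0 : 'I_(d + 1). *)
Definition CM d (G : 'M[R]_d) : 'M[R]_(d + 1) :=
  block_mx (- (2^-1 *: G)) (const_mx 1) (- const_mx 1) 0.

(* The index list i, C (in increasing order), d+1. For i \notin C another
   ordering only changes the sign of the minors below. *)
Definition CM_index d (i : 'I_d) (C : {set 'I_d})
    (t : 'I_(1 + (#|C| + 1))) : 'I_(d + 1) :=
  match fintype.split t with
  | inl _ => lshift 1 i
  | inr u => match fintype.split u with
             | inl c => lshift 1 (enum_val c)
             | inr o => rshift d o
             end
  end.

Definition CM_submx d (G : 'M[R]_d) (i j : 'I_d) (C : {set 'I_d}) :
    'M[R]_(1 + (#|C| + 1)) :=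
  mxsub (@CM_index d i C) (@CM_index d j C) (CM G).

(* Sigma^(k); lift k enumerates the indices different from k. *)
Definition HR_Sigma d (G : 'M[R]_d) (k : 'I_d) : 'M[R]_(d.-1) :=
  \matrix_(i, j) (2^-1 * (G (lift k i) k + G (lift k j) k
                          - G (lift k i) (lift k j))).

Definition HR_mean d (G : 'M[R]_d) (k : 'I_d) : 'cV[R]_(d.-1) :=
  \col_i (- (2^-1 * HR_Sigma G k i i)).

End matrices.

Definition eq_in_law {R : realType} {d1 d2 d' : measure_display}
    {T1 : measurableType d1} {T2 : measurableType d2} {V : measurableType d'}
    (P1 : probability T1 R) (X1 : T1 -> V)
    (P2 : probability T2 R) (X2 : T2 -> V) : Prop :=
  forall B, measurable B -> P1 (X1 @^-1` B) = P2 (X2 @^-1` B).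

Section probability_notions.
Context {R : realType} {dT : measure_display} {T : measurableType dT}.
Implicit Types P : probability T R.

Definition independent_rv {d1 d2 : measure_display}
    {V1 : measurableType d1} {V2 : measurableType d2}
    P (X1 : T -> V1) (X2 : T -> V2) : Prop :=
  forall B1 B2, measurable B1 -> measurable B2 ->
    P (X1 @^-1` B1 `&` X2 @^-1` B2) = (P (X1 @^-1` B1) * P (X2 @^-1` B2))%E.

(* f is a version of the conditional probability P(A | sigma(Z)). *)
Definition is_cond_prob {d' : measure_display} {V : measurableType d'}
    P (Z : T -> V) (A : set T) (f : T -> R) : Prop :=
  [/\ forall B : set R, measurable B -> g_sigma_algebra_preimage Z (f @^-1` B),
      P.-integrable [set: T] (EFin \o f) &
      forall D : set T, g_sigma_algebra_preimage Z D ->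
        (\int[P]_(w in D) (f w)%:E)%E = P (A `&` D)].

Definition cond_independent {d1 d2 d3 : measure_display}
    {V1 : measurableType d1} {V2 : measurableType d2} {V3 : measurableType d3}
    P (X1 : T -> V1) (X2 : T -> V2) (Z : T -> V3) : Prop :=
  forall (B1 : set V1) (B2 : set V2), measurable B1 -> measurable B2 ->
  exists f1 f2 f12 : T -> R,
    [/\ is_cond_prob P Z (X1 @^-1` B1) f1,
        is_cond_prob P Z (X2 @^-1` B2) f2,
        is_cond_prob P Z (X1 @^-1` B1 `&` X2 @^-1` B2) f12 &
        {ae P, forall w, f12 w = f1 w * f2 w}].

(* The coordinates of Z are i.i.d. N(0, 1). *)
Definition standard_gaussian l P (Z : T -> l.-tuple R) : Prop :=
  forall B : 'I_l -> set R, (forall i, measurable (B i)) ->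
    P [set w | forall i, B i (tnth (Z w) i)] =
    (\prod_(i < l) normal_prob 0 1 (B i))%E.

Definition exponential P (r : R) (E : T -> R) : Prop :=
  forall B : set R, measurable B -> P (E @^-1` B) = exponential_prob r B.

End probability_notions.

(* X has the same law as m + A Z with Z standard Gaussian and A A^T = S. *)
Definition gaussian {R : realType} {dT : measure_display}
    {T : measurableType dT} n (P : probability T R) (X : T -> n.-tuple R)
    (m : 'cV[R]_n) (S : 'M[R]_n) : Prop :=
  exists (l : nat) (A : 'M[R]_(n, l)) (d' : measure_display)
         (T' : measurableType d') (P' : probability T' R)
         (Z : {RV P' >-> l.-tuple R}),
    [/\ A *m A^T = S, standard_gaussian P' Z &
        eq_in_law P X P' (fun w =>
          [tuple (m + A *m \col_j tnth (Z w) j) i 0 | i < n])].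

Section random_vectors.
Context {R : realType} {dT : measure_display} {T : measurableType dT}.
Implicit Types P : probability T R.

Lemma measurable_exceed d (Y : {mfun T >-> d.-tuple R}) (k : 'I_d) :
  measurable [set w | 0 < tnth (Y w) k].
Proof.
have mY : measurable_fun [set: T] (fun w => tnth (Y w) k).
  by apply: (measurableT_comp (measurable_tnth k)).
rewrite (_ : [set _ | _] = (fun w => tnth (Y w) k) @^-1` `]0, +oo[%classic).
  by rewrite -[X in measurable X]setTI; exact: mY.
by apply/seteqP; split => w /=; rewrite in_itv/= andbT.
Qed.

(* The conditional probability P( . | Y_k > 0), under which Y has the law of
   Y^k. When P(Y_k > 0) = 0, mnormalize falls back to its last argument; this
   case is excluded in huesler_reiss. *)
Definition exceed_prob d P (Y : {mfun T >-> d.-tuple R}) (k : 'I_d)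
    : probability T R :=
  mnormalize (mrestr P (measurable_exceed Y k)) P.

Definition huesler_reiss d P (Y : {RV P >-> d.-tuple R}) (G : 'M[R]_d)
    : Prop :=
  [/\ {ae P, forall w, exists i, 0 < tnth (Y w) i},
      forall k, (0 < P [set w | (0 < tnth (Y w) k)%R])%E &
      forall k, exists (d' : measure_display) (T' : measurableType d')
          (P' : probability T' R) (E : {RV P' >-> R})
          (W : {RV P' >-> d.-tuple R}),
        [/\ exponential P' 1 E,
            independent_rv P' E W,
            forall w, tnth (W w) k = 0,
            gaussian P' (fun w => [tuple tnth (W w) (lift k i) | i < d.-1])
              (HR_mean G k) (HR_Sigma G k) &
            eq_in_law (exceed_prob P Y k) Y
              P' (fun w => [tuple E w + tnth (W w) i | i < d])]].

Definition subvector d (A : {set 'I_d}) (y : d.-tuple R) : #|A|.-tuple R :=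
  [tuple tnth y (enum_val i) | i < #|A|].

Definition ext_cond_independent d P (Y : {RV P >-> d.-tuple R})
    (A B C : {set 'I_d}) : Prop :=
  forall k, k \in A :|: B :|: C ->
    cond_independent (exceed_prob P Y k)
      (subvector A \o Y) (subvector B \o Y) (subvector C \o Y).

End random_vectors.

(* Main.v *)
(* For x with coordinate sum 0, x . Y is invariant under shifts of Y along
   (1, ..., 1), and under P( . | Y_k > 0) it is independent of every function of
   Y that is invariant under translation by Sigma^(k) x: this is rotation
   invariance of the standard Gaussian. Solving the linear system given by the
   Cayley-Menger matrix on C and d+1 yields the residuals U of Y_i and V of Y_j
   after regression on Y_C, and by a Schur complement the determinant is a
   nonzero multiple of the covariance of U and V.

   If it vanishes, V is independent of (Y_i, Y_C) under P( . | Y_k > 0) for k in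
   C; homogeneity of the exponent measure transports this to P( . | Y_i > 0), and
   exchanging i and j settles P( . | Y_j > 0). If it does not vanish, then
   V = V' + c U with c nonzero and U, V', Y_C independent, and the events Y_j > 0
   and c Y_i > 0 are not conditionally independent given any value of Y_C. *)
From HB Require Import structures.
Require Import Defs.
From mathcomp Require Import all_boot all_order all_algebra.
From mathcomp Require Import all_classical all_reals all_analysis.
From mathcomp Require Import measurable_realfun.
From mathcomp Require Import ring lra.

Set Implicit Arguments.
Unset Strict Implicit.
Unset Printing Implicit Defensive.

Import Order.TTheory GRing.Theory Num.Theory.
Import numFieldNormedType.Exports.

Local Open Scope classical_set_scope.
Local Open Scope ring_scope.

(** The regression weights sum to 1 so that a residual does not see the exponential component [E],
    which moves all coordinates together; the entry of the solution at index d+1 is the multiplier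
    of this constraint. Under P( . | Y_k > 0) the vector [dirv G k x] lists the covariances of x . Y
    with the coordinates of Y, so a function invariant along it depends only on what is uncorrelated
    with x . Y. Phrased through invariance, independence pulls back directly to the standard
    Gaussian behind [gaussian], without densities in R^d; the one computation with densities is a
    rotation of the plane. Conditional independence asks for actual versions of the conditional
    probabilities. The residual yields an explicit kernel for Y_j, while the version for Y_i comes
    from Radon-Nikodym. In the converse, uniqueness of versions replaces the given ones by explicit
    functions of Y_C, so that one value of Y_C off a null set already gives a contradiction. The
    dependence on U is monotone, hence half-lines suffice as events, and the sign of the covariance
    is absorbed into U to make the slope positive. *)

Section independence.
Context {R : realType} {dT : measure_display} {T : measurableType dT}.
Context {d1 d2 : measure_display}.
Context {V1 : measurableType d1} {V2 : measurableType d2}.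
Implicit Types (P : probability T R) (X : T -> V1) (Y : T -> V2).

Lemma measurable_preimage (f : T -> V1) (B : set V1) :
  measurable_fun setT f -> measurable B -> measurable (f @^-1` B).
Proof. by move=> mf mB; rewrite -[X in measurable X]setTI; exact: mf. Qed.

Lemma measurable_pair X Y : measurable_fun setT X -> measurable_fun setT Y ->
  measurable_fun setT (fun w => (X w, Y w)).
Proof. by move=> mX mY; exact/measurable_fun_pairP. Qed.

Lemma independent_rvC P X Y : independent_rv P X Y -> independent_rv P Y X.
Proof. by move=> XY B1 B2 mB1 mB2; rewrite setIC XY// muleC. Qed.

(** Independence makes the joint law agree with the product of the two laws on rectangles, hence on
    the whole product sigma-algebra; the integral is the mass of [S] under that product, pulled back
    to [T]. *)
Lemma independent_integral_xsection P X Y (S : set (V1 * V2)) :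
  measurable_fun setT X -> measurable_fun setT Y -> independent_rv P X Y ->
  measurable S ->
  P [set w | S (X w, Y w)] = (\int[P]_w P (Y @^-1` xsection S (X w)))%E.
Proof.
move=> mX mY XY mS.
pose X' : {mfun T >-> V1} := HB.pack X (isMeasurableFun.Build _ _ _ _ X mX).
pose Y' : {mfun T >-> V2} := HB.pack Y (isMeasurableFun.Build _ _ _ _ Y mY).
pose XY' : {mfun T >-> (V1 * V2)%type} := HB.pack (fun w => (X w, Y w))
  (isMeasurableFun.Build _ _ _ _ (fun w => (X w, Y w)) (measurable_pair mX mY)).
have := @product_measure_unique _ _ V1 V2 R (distribution P X')
  (distribution P Y') (distribution P XY').
move=> /(_ (fun A B mA mB => XY A B mA mB)) /(_ S mS).
rewrite [RHS]/= /distribution/= /pushforward/= => <-.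
rewrite /product_measure1 ge0_integral_pushforward//.
exact: (measurable_fun_xsection (distribution P Y')).
Qed.

Lemma measurable_prob_xsection P X (S : set (V2 * V1)) :
  measurable_fun setT X -> measurable S ->
  measurable_fun setT (fun z => P [set u | S (z, X u)]).
Proof.
move=> mX mS.
pose X' : {mfun T >-> V1} := HB.pack X (isMeasurableFun.Build _ _ _ _ X mX).
rewrite (_ : (fun z => _) = distribution P X' \o xsection S).
  exact: measurable_fun_xsection.
apply/funext => z; rewrite /= /distribution /pushforward/=.
by congr (P _); apply/seteqP; split => u /=; rewrite xsectionE.
Qed.

End independence.

(** * One-dimensional substitutions and densities *)

Section affine_change_of_variable.
Context {R : realType}.
Local Notation mu := (@lebesgue_measure R).

Let affine_preimage_itv (a b u v : R) : 0 < a ->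
  (fun x => a * x + b) @^-1` `]u, v]%classic
  = `](u - b) / a, (v - b) / a]%classic.
Proof.
move=> a0; apply/seteqP; split => x /=; rewrite !in_itv/=.
  by rewrite ltr_pdivrMr// ler_pdivlMr// !(mulrC x); lra.
by rewrite ltr_pdivrMr// ler_pdivlMr// !(mulrC x); lra.
Qed.

Let affine_preimage_itvN (a b u v : R) : a < 0 ->
  (fun x => a * x + b) @^-1` `]u, v]%classic
  = `[(v - b) / a, (u - b) / a[%classic.
Proof.
move=> a0; apply/seteqP; split => x /=; rewrite !in_itv/=.
  by rewrite ltr_ndivlMr// ler_ndivrMr// !(mulrC x); lra.
by rewrite ltr_ndivlMr// ler_ndivrMr// !(mulrC x); lra.
Qed.

Let maffine (a b : R) : measurable_fun setT
  ((fun x : R => a * x + b) : measurableTypeR R -> measurableTypeR R).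
Proof. by apply: measurable_funD => //; exact: measurable_funM. Qed.

(** The pushforward scaled by |a| gives every half-open interval its length, which characterises
    Lebesgue measure. For a < 0 the preimages are half-open on the other side, with the same
    length. *)
Lemma lebesgue_measure_affine (a b : R) (A : set R) : a != 0 -> measurable A ->
  mu A = ((`|a|)%R%:E * mu ((fun x => (a * x + b)%R) @^-1` A))%E.
Proof.
move=> a0 mA.
pose f : {mfun measurableTypeR R >-> measurableTypeR R} :=
  HB.pack (fun x : R => a * x + b)
    (isMeasurableFun.Build _ _ (measurableTypeR R) (measurableTypeR R) _ (maffine a b)).
pose na : {nonneg R} := NngNum (normr_ge0 a).
rewrite (@lebesgue_measure_unique R (mscale na (pushforward mu f)))//.
move=> _ [[u v] _ <-] /=.
rewrite /mscale/= /pushforward/=.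
case: (ltgtP a 0) a0 => // a0 _.
  rewrite affine_preimage_itvN// !lebesgue_measure_itv/= !lte_fin.
  rewrite ltr_nM2r ?invr_lt0// ltrD2r; case: ifPn => uv; last by rewrite mule0.
  rewrite -!EFinB -EFinM ltr0_norm//; congr EFin; field.
  by rewrite lt_eqF.
rewrite affine_preimage_itv// !lebesgue_measure_itv/= !lte_fin.
rewrite ltr_pM2r ?invr_gt0// ltrD2r; case: ifPn => uv; last by rewrite mule0.
rewrite -!EFinB -EFinM gtr0_norm//; congr EFin; field.
by rewrite gt_eqF.
Qed.

Lemma ge0_integral_affine (a b : R) (f : R -> \bar R) : a != 0 ->
  measurable_fun setT f -> (forall x, (0 <= f x)%E) ->
  (\int[mu]_x f x = (`|a|)%R%:E * \int[mu]_x f (a * x + b)%R)%E.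
Proof.
move=> a0 mf f0.
pose g : {mfun measurableTypeR R >-> measurableTypeR R} :=
  HB.pack (fun x : R => a * x + b)
    (isMeasurableFun.Build _ _ (measurableTypeR R) (measurableTypeR R) _ (maffine a b)).
pose na : {nonneg R} := NngNum (normr_ge0 a).
have mg : measurable_fun setT g by [].
have -> : (\int[mu]_x f x = \int[mscale na
    (measure_function_pushforward__canonical__measure_function_Measure mu mg)]_x
    f x)%E.
  by apply: eq_measure_integral => A mA _; exact: lebesgue_measure_affine.
rewrite ge0_integral_mscale//=; congr (_ * _)%E.
by rewrite (@ge0_integral_pushforward _ _ _ _ _ _ mg mu setT f).
Qed.

End affine_change_of_variable.

(** Both [p] and the Radon-Nikodym derivative integrate to [nu] over every measurable set, so they
    agree almost everywhere, and the change of variables for the derivative carries over to [p]. *)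
Lemma finite_integral_density {R : realType} {d : measure_display}
    {T : measurableType d} (nu : {finite_measure set T -> \bar R})
    (mu : {sigma_finite_measure set T -> \bar R}) (f p : T -> \bar R) :
  mu.-integrable setT p ->
  (forall A, measurable A -> nu A = (\int[mu]_(x in A) p x)%E) ->
  nu.-integrable setT f ->
  (\int[nu]_x f x = \int[mu]_x (f x * p x))%E.
Proof.
move=> ip nuE fi.
have numu : nu `<< mu.
  apply/null_content_dominatesP => A mA muA0; rewrite nuE//.
  apply: null_set_integral => //.
  exact: measurable_funTS (measurable_int _ ip).
have mf := measurable_int _ fi; have mp := measurable_int _ ip.
rewrite -(Radon_Nikodym_change_of_variables numu)//.
apply: ae_eq_integral => //.
- by apply: emeasurable_funM => //; apply: measurable_int;
    exact: Radon_Nikodym_integrable.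
- exact: emeasurable_funM.
- apply: ae_eqe_mul2l; apply: integral_ae_eq => //.
    exact: Radon_Nikodym_integrable.
  by move=> A _ mA; rewrite -Radon_Nikodym_integral//; exact: nuE.
Qed.

(** * Rotation invariance of the Gaussian law in the plane *)

Section gaussian_rotation.
Context {R : realType}.
Local Notation mu := (@lebesgue_measure R).
Local Notation phi := (@normal_pdf R 0 1).
Local Notation N := (@normal_prob R 0 1).

Let mphi : measurable_fun setT (phi : measurableTypeR R -> measurableTypeR R).
Proof. exact: measurable_normal_pdf. Qed.

Let phiE (x y u v : R) : x ^+ 2 + y ^+ 2 = u ^+ 2 + v ^+ 2 ->
  phi x * phi y = phi u * phi v.
Proof.
move=> xyuv; rewrite /normal_pdf oner_eq0 /normal_fun !subr0.
rewrite mulrACA [RHS]mulrACA; congr (_ * _).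
by rewrite -!expRD -!mulrDl -!opprD xyuv.
Qed.

Lemma integral_normal_prob_bounded (f : R -> \bar R) : measurable_fun setT f ->
  (forall x, (0 <= f x <= 1)%E) ->
  (\int[N]_x f x = \int[mu]_x (f x * (phi x)%:E))%E.
Proof.
move=> mf f01.
apply: (@finite_integral_density R _ _ N mu f (EFin \o phi)) => //.
  exact: integrable_normal_pdf.
apply/integrableP; split => //.
apply: (@le_lt_trans _ _ (\int[N]_x cst 1 x)%E).
  apply: ge0_le_integral => //.
    exact: measurableT_comp.
  by move=> x _; case/andP: (f01 x) => *; rewrite gee0_abs.
by rewrite integral_cst// mul1e [ltLHS](probability_setT N) ltry.
Qed.

Let normal_prob_indic (A : set R) : measurable A ->
  N A = (\int[mu]_x (\1_A x * phi x)%:E)%E.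
Proof.
move=> mA; rewrite /normal_prob integral_mkcond; apply: eq_integral => x _.
by rewrite epatch_indic/= -EFinM mulrC.
Qed.

(** The product density depends on x^2 + y^2 only ([phiE]). The rotation is performed one variable
    at a time: an affine substitution in y, an exchange of the integrals, an affine substitution in
    x. Dividing by [c] is where c != 0 enters. *)
Lemma normal_prob_rotation (c s : R) (A B : set R) : c != 0 ->
  c ^+ 2 + s ^+ 2 = 1 -> measurable A -> measurable B ->
  (N \x N)%E [set q | A (c * q.1 + s * q.2) /\ B (- s * q.1 + c * q.2)]
  = (N A * N B)%E.
Proof.
move=> c0 cs mA mB.
set S := [set q | _].
have lin (a b : R) : measurable_fun setT (fun q : R * R => a * q.1 + b * q.2).
  by apply: measurable_funD => //; exact: measurable_funM.
have mcomp (f : R -> R) (a b : R) : measurable_fun setT f ->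
    measurable_fun setT (fun q : R * R => f (a * q.1 + b * q.2)).
  by move=> mf; exact: (measurableT_comp mf (lin a b)).
have mS : measurable S.
  rewrite (_ : S = (fun q => c * q.1 + s * q.2) @^-1` A `&`
      (fun q => - s * q.1 + c * q.2) @^-1` B)//.
  by apply: measurableI; exact: measurable_preimage.
pose F (x y : R) :=
  \1_A (c * x + s * y) * \1_B (- s * x + c * y) * (phi x * phi y).
have F0 x y : 0 <= F x y.
  by rewrite /F mulr_ge0// ?mulr_ge0 ?normal_pdf_ge0.
(* For fixed x, the substitution y = (u + s x) / c makes u the second rotated coordinate. *)
pose G (x u : R) := F x (c^-1 * u + s * x / c).
have mF : measurable_fun setT (fun q : R * R => F q.1 q.2).
  apply: measurable_funM; apply: measurable_funM.
  - exact: (mcomp (\1_A) c s (measurable_indic mA)).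
  - exact: (mcomp (\1_B) (- s) c (measurable_indic mB)).
  - exact: measurableT_comp mphi measurable_fst.
  - exact: measurableT_comp mphi measurable_snd.
have mG : measurable_fun setT (fun q : R * R => G q.1 q.2).
  apply: (measurableT_comp mF (_ : measurable_fun setT
    (fun q : R * R => (q.1, c^-1 * q.2 + s * q.1 / c)))).
  apply: measurable_pair => //; apply: measurable_funD.
    exact: measurable_funM.
  by apply: measurable_funM => //; exact: measurable_funM.
rewrite /product_measure1 integral_normal_prob_bounded; last 2 first.
- exact: (measurable_fun_xsection N).
- by move=> x; rewrite measure_ge0/= probability_le1//; exact: measurable_xsection.
have innerE x : (N (xsection S x) * (phi x)%:E =
    \int[mu]_u (`|c^-1|%R%:E * (G x u)%:E))%E.
  rewrite normal_prob_indic; last exact: measurable_xsection.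
  rewrite -ge0_integralZr//=; last 3 first.
  - apply/measurable_EFinP; apply: measurable_funM => //.
    by apply: measurable_indic; exact: measurable_xsection.
  - by move=> y _; rewrite lee_fin mulr_ge0// normal_pdf_ge0.
  - by rewrite lee_fin normal_pdf_ge0.
  transitivity (\int[mu]_y (F x y)%:E)%E.
    apply: eq_integral => y _; rewrite -EFinM; congr EFin.
    rewrite /F [phi x * _]mulrC mulrA; congr (_ * _ * _).
    rewrite !indicE -natrM mulnb; congr ((nat_of_bool _)%:R).
    by apply/idP/andP; rewrite !inE /xsection/= inE.
  have mFx : measurable_fun setT (fun y : R => (F x y)%:E).
    apply/measurable_EFinP.
    exact: (measurableT_comp mF (pair1_measurable x)).
  rewrite (@ge0_integral_affine R c^-1 (s * x / c)) ?invr_eq0//.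
  rewrite ge0_integralZl//.
    apply/measurable_EFinP.
    exact: (measurableT_comp mG (pair1_measurable x)).
  by move=> u _; rewrite lee_fin; exact: F0.
  by move=> u; rewrite lee_fin; exact: F0.
under eq_integral do rewrite innerE.
rewrite (@fubini_tonelli _ _ _ _ R mu mu
  (fun q => `|c^-1|%R%:E * (G q.1 q.2)%:E)%E)//=; last 2 first.
- by apply: measurable_funeM; exact/measurable_EFinP.
- by move=> q; rewrite mule_ge0// lee_fin; exact: F0.
have inner2 u : (\int[mu]_x (`|c^-1|%R%:E * (G x u)%:E) =
    N A * (\1_B u * phi u)%:E)%E.
  have mGu : measurable_fun setT (fun x : R => (G x u)%:E).
    apply/measurable_EFinP.
    exact: (measurableT_comp mG (pair2_measurable u)).
  rewrite ge0_integralZl//; last by move=> x _; rewrite lee_fin; exact: F0.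
  (* For fixed u, the substitution x = c v - s u makes v the first rotated coordinate; its factor
     |c| cancels the factor |1/c| of the earlier one. *)
  rewrite (@ge0_integral_affine R c (- s * u))//.
  rewrite muleA -EFinM -normrM mulVf// normr1 mul1e.
  rewrite normal_prob_indic// -ge0_integralZr//=; last 3 first.
  - by apply/measurable_EFinP; exact: measurable_funM.
  - by move=> v _; rewrite lee_fin mulr_ge0// normal_pdf_ge0.
  - by rewrite lee_fin mulr_ge0// normal_pdf_ge0.
  apply: eq_integral => v _; rewrite -EFinM; congr EFin.
  rewrite /G /F.
  have -> : c^-1 * u + s * (c * v + - s * u) / c = s * v + c * u.
    apply: (mulfI c0); rewrite !mulrDr !mulrA mulfV// mul1r.
    rewrite [X in _ + X](_ : _ = s * (c * v - s * u)).
      by rewrite -[in X in X + _](mul1r u) -cs; ring.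
    by field.
  rewrite (_ : c * _ + s * _ = v); last first.
    by rewrite -[RHS]mul1r -cs; ring.
  rewrite (_ : - s * _ + c * _ = u); last first.
    by rewrite -[RHS]mul1r -cs; ring.
  rewrite (phiE (u := v) (v := u)); first by ring.
  by rewrite -[RHS]mul1r -cs; ring.
  by move=> x; rewrite lee_fin; exact: F0.
under eq_integral do rewrite inner2.
rewrite ge0_integralZl//; last 2 first.
- by apply/measurable_EFinP; exact: measurable_funM.
- by move=> v _; rewrite lee_fin mulr_ge0// normal_pdf_ge0.
by rewrite -normal_prob_indic.
Qed.

End gaussian_rotation.

(** * Finite measures determined by rectangles and boxes *)

Lemma measure_eq_rectangles {R : realType} {d1 d2 : measure_display}
    {V1 : measurableType d1} {V2 : measurableType d2}
    (m1 m2 : {measure set (V1 * V2)%type -> \bar R}) :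
  (m1 setT < +oo)%E ->
  (forall A B, measurable A -> measurable B -> m1 (A `*` B) = m2 (A `*` B)) ->
  forall S, measurable S -> m1 S = m2 S.
Proof.
move=> m1oo m12 S mS.
pose G := [set A `*` B | A in @measurable _ V1 & B in @measurable _ V2].
apply: (measure_unique G (fun=> setT)) => //.
- exact: measurable_prod_measurableType.
- move=> _ _ [A1 mA1 [B1 mB1 <-]] [A2 mA2 [B2 mB2 <-]].
  exists (A1 `&` A2); first exact: measurableI.
  by exists (B1 `&` B2); [exact: measurableI|rewrite setXI].
- by move=> _; exists setT => //; exists setT => //; rewrite setXTT.
- by rewrite bigcup_const//; exists 0%N.
- by move=> _ [A mA [B mB <-]]; exact: m12.
Qed.

Definition box {R : realType} l (B : 'I_l -> set R) : set (l.-tuple R) :=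
  [set z | forall i, B i (tnth z i)].

Lemma measurable_box {R : realType} l (B : 'I_l -> set R) :
  (forall i, measurable (B i)) -> measurable (box B).
Proof.
move=> mB; rewrite (_ : box B = \bigcap_(i in [set: 'I_l])
    ((@tnth l R)^~ i @^-1` B i)).
  apply: fin_bigcap_measurable => [|i _]; first exact: finite_finset.
  by apply: measurable_preimage => //; exact: measurable_tnth.
by apply/seteqP; split => [z Bz i _|z Bz i]; exact: Bz.
Qed.

Lemma measure_eq_boxes {R : realType} l
    (m1 m2 : {measure set (l.-tuple R) -> \bar R}) :
  (m1 setT < +oo)%E ->
  (forall B, (forall i, measurable (B i)) -> m1 (box B) = m2 (box B)) ->
  forall S, measurable S -> m1 S = m2 S.
Proof.
move=> m1oo m12 S mS.
pose G := [set box B | B in [set B : 'I_l -> set R |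
    forall i : 'I_l, measurable (B i)]].
have GT : G setT.
  by exists (fun=> setT) => //; apply/seteqP; split.
apply: (measure_unique G (fun=> setT)) => //.
- apply/seteqP; split; last first.
    apply: smallest_sub; first exact: sigma_algebra_measurable.
    by move=> _ [B mB <-]; exact: measurable_box.
  apply: smallest_sub; first exact: smallest_sigma_algebra.
  elim/big_ind : _ => // [A B subA subB|i _]; first by rewrite subUset.
  move=> _ [A mA <-]; apply: sub_sigma_algebra.
  (* The generators of the sigma-algebra on tuples are preimages under one coordinate, that is,
     boxes with a single side other than the full line. *)
  exists (fun j => if j == i then A else setT).
    by move=> j /=; case: ifP.
  apply/seteqP; split => z /= => [/(_ i)|[_ Az] j]; first by rewrite eqxx.
  by case: eqP => // ->.
- move=> _ _ [A mA <-] [B mB <-]; exists (fun i => A i `&` B i).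
    by move=> i; exact: measurableI.
  apply/seteqP; split => z /= => [AB|[Az Bz] i]; last by split.
  by split=> i; have [] := AB i.
- by rewrite bigcup_const//; exists 0%N.
- by move=> _ [B mB <-]; exact: m12.
Qed.

Lemma measurable_mktuple {R : realType} {d : measure_display}
    {T : measurableType d} l (f : 'I_l -> T -> R) :
  (forall i, measurable_fun setT (f i)) ->
  measurable_fun setT (fun w => [tuple f i w | i < l]).
Proof.
move=> mf; apply/measurable_fun_tnthP => i.
by rewrite (_ : _ \o _ = f i)//; apply/funext => w /=; rewrite tnth_mktuple.
Qed.

Lemma measurable_tnth_comp {R : realType} {d : measure_display}
    {T : measurableType d} l (f : T -> l.-tuple R) i :
  measurable_fun setT f -> measurable_fun setT (fun w => tnth (f w) i).
Proof. by move=> mf; exact: (measurableT_comp (measurable_tnth i) mf). Qed.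

(** * Rotations of the standard Gaussian in a coordinate plane *)

Section standard_gaussian_rotation.
Context {R : realType} {dT : measure_display} {T : measurableType dT}.
Variables (P : probability T R) (l : nat).
Local Notation N := (@normal_prob R 0 1).

Definition givens (p q : 'I_l) (c s : R) (z : l.-tuple R) : l.-tuple R :=
  [tuple if i == p then c * tnth z p + s * tnth z q
         else if i == q then - s * tnth z p + c * tnth z q
         else tnth z i | i < l].

Lemma measurable_givens p q c s : measurable_fun setT (givens p q c s).
Proof.
have mt i : measurable_fun setT (fun z : l.-tuple R => tnth z i).
  exact: measurable_tnth.
apply: (@measurable_mktuple R _ _ l (fun i z =>
  if i == p then c * tnth z p + s * tnth z q
  else if i == q then - s * tnth z p + c * tnth z q else tnth z i)) => i.
case: (i == p); first by apply: measurable_funD; apply: measurable_funM.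
by case: (i == q) => //; apply: measurable_funD; apply: measurable_funM.
Qed.

(** The conditions on the coordinates other than p and q are frozen in the event [E0]. On [E0] the
    pair of coordinates p and q is distributed as [K] times the planar Gaussian law, to which the
    planar rotation applies. *)
Lemma standard_gaussian_givens (Z : T -> l.-tuple R) p q (c s : R) :
  measurable_fun setT Z -> standard_gaussian P Z -> p != q -> c != 0 ->
  c ^+ 2 + s ^+ 2 = 1 -> standard_gaussian P (givens p q c s \o Z).
Proof.
move=> mZ gZ pq c0 cs B mB.
pose K : R := fine (\prod_(i < l | (i != p) && (i != q)) N (B i))%E.
have Kfin : (\prod_(i < l | (i != p) && (i != q)) N (B i))%E \is a fin_num.
  elim/big_rec : _ => // i x _ xfin; rewrite fin_numM//.
  by apply: (@fin_num_measure _ _ _ N); exact: mB.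
have K0 : 0 <= K.
  by apply: fine_ge0; elim/big_rec : _ => // i x _ x0; rewrite mule_ge0.
pose B' A1 A2 i := if i == p then A1 else if i == q then A2 else B i.
have prodB' A1 A2 : (\prod_(i < l) N (B' A1 A2 i) = K%:E * (N A1 * N A2))%E.
  rewrite (bigD1 p)//= (bigD1 q)//=; last by rewrite eq_sym.
  rewrite /B' !eqxx eq_sym (negbTE pq) muleA muleC fineK//; congr (_ * _)%E.
  by apply: eq_bigr => i /andP[/negbTE -> /negbTE ->].
pose E0 := [set w | forall i, (i != p) && (i != q) -> B i (tnth (Z w) i)].
have mE0 : measurable E0.
  rewrite (_ : E0 = Z @^-1` box (B' setT setT)).
    apply: measurable_preimage => //; apply: measurable_box => i.
    by rewrite /B'; case: ifP => // _; case: ifP.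
  apply/seteqP; split => w /= Bw i.
    by rewrite /B'; case: eqP => // /eqP ip; case: eqP => // /eqP iq;
      apply: Bw; rewrite ip.
  by case/andP => ip iq; have := Bw i; rewrite /B' (negbTE ip) (negbTE iq).
pose f w : measurableTypeR R * measurableTypeR R :=
  (tnth (Z w) p, tnth (Z w) q).
have mf : measurable_fun setT f.
  by apply: measurable_pair; exact: measurable_tnth_comp.
pose g : {mfun T >-> (measurableTypeR R * measurableTypeR R)%type} :=
  HB.pack f (isMeasurableFun.Build _ _ _ _ f mf).
have mg : measurable_fun setT g by [].
pose m1 := measure_function_pushforward__canonical__measure_function_Measure
  (mrestr P mE0) mg.
pose m2 : {measure set _ -> \bar R} := mscale (NngNum K0) (N \x N)%E.
have m12 : forall S, measurable S -> m1 S = m2 S.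
  apply: measure_eq_rectangles.
    rewrite /m1/= /pushforward/= /mrestr/=.
    apply: le_lt_trans (ltry 1); apply: probability_le1.
    by rewrite preimage_setT setTI.
  move=> A1 A2 mA1 mA2.
  rewrite /m1 /m2/= /pushforward/= /mrestr/= /mscale/=.
  rewrite (@product_measure1E _ _ _ _ _ N N)// -prodB'.
  rewrite -gZ; last by move=> i; rewrite /B'; case: ifP => // _; case: ifP.
  congr (P _); apply/seteqP; split => w /=.
    move=> [[A1w A2w] Bw] i; rewrite /B'; case: eqP => [-> //|/eqP ip].
    by case: eqP => [-> //|/eqP iq]; apply: Bw; rewrite ip.
  move=> Bw; split; first split.
  - by have := Bw p; rewrite /B' eqxx.
  - by have := Bw q; rewrite /B' eqxx eq_sym (negbTE pq).
  - move=> i /andP[ip iq]; have := Bw i.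
    by rewrite /B' (negbTE ip) (negbTE iq).
pose S := [set u : R * R | B p (c * u.1 + s * u.2) /\ B q (- s * u.1 + c * u.2)].
have mS : measurable S.
  have lin (a b : R) : measurable_fun setT (fun q : R * R => a * q.1 + b * q.2).
    by apply: measurable_funD => //; exact: measurable_funM.
  rewrite (_ : S = (fun q => c * q.1 + s * q.2) @^-1` B p `&`
      (fun q => - s * q.1 + c * q.2) @^-1` B q)//.
  by apply: measurableI; apply: measurable_preimage.
transitivity (m1 S).
  rewrite /m1/= /pushforward/= /mrestr/=; congr (P _).
  apply/seteqP; split => w /=.
    move=> Bw; split; first split => /=.
    - by have := Bw p; rewrite tnth_mktuple eqxx.
    - by have := Bw q; rewrite tnth_mktuple eqxx eq_sym (negbTE pq).
    - move=> i /andP[ip iq]; have := Bw i.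
      by rewrite tnth_mktuple (negbTE ip) (negbTE iq).
  move=> [[Bp Bq] Bw] i; rewrite tnth_mktuple.
  case: eqP => [-> //|/eqP ip]; case: eqP => [-> //|/eqP iq].
  by apply: Bw; rewrite ip.
rewrite m12// /m2/= /mscale/= normal_prob_rotation// -prodB'.
by apply: eq_bigr => i _; rewrite /B'; case: eqP => [->|_] //; case: eqP => [->|].
Qed.

End standard_gaussian_rotation.

(** * A linear form in a standard Gaussian and the functions it is independent of *)

Section gaussian_independence.
Context {R : realType} {dT : measure_display} {T : measurableType dT}.
Variables (P : probability T R) (l : nat).
Local Notation N := (@normal_prob R 0 1).
Local Notation mu := (@lebesgue_measure R).

Definition addz (z : l.-tuple R) (t : R) (a : 'I_l -> R) : l.-tuple R :=
  [tuple tnth z i + t * a i | i < l].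

Definition dotz (a : 'I_l -> R) (z : l.-tuple R) : R := \sum_i a i * tnth z i.

(** The normal density is positive everywhere, so a set over which its integral vanishes is Lebesgue
    null. *)
Lemma normal_prob_eq0 (A : set R) : measurable A -> N A = 0%E -> mu A = 0%E.
Proof.
move=> mA NA0.
have mphi : measurable_fun A (fun x => (normal_pdf 0 1 x)%:E : \bar R).
  by apply/measurable_EFinP/measurable_funTS; exact: measurable_normal_pdf.
have : (\int[mu]_(x in A) `|(normal_pdf 0 1 x)%:E|)%E = 0%E.
  rewrite -[RHS]NA0; apply: eq_integral => x _.
  by rewrite gee0_abs// lee_fin normal_pdf_ge0.
move/(ae_eq_integral_abs mu mA mphi) => /= Aneg.
apply/(negligibleP mu) => //.
apply: negligibleS Aneg => x Ax /= /(_ Ax) /eqP.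
rewrite /= eqe /normal_pdf oner_eq0 mulf_eq0 gt_eqF ?normal_peak_gt0 ?oner_eq0//=.
by rewrite gt_eqF// expR_gt0.
Qed.

(** A half-line has infinite Lebesgue measure, and so has its preimage under x -> r x; a set of
    normal probability 0 would be Lebesgue null. *)
Lemma normal_prob_half_line_gt0 (r t : R) : r != 0 ->
  (0 < N [set x | (t < r * x)%R])%E /\ (0 < N [set x | (r * x <= t)%R])%E.
Proof.
move=> r0.
have pos (A : set R) : measurable A -> (mu A = +oo)%E ->
    (0 < N [set x | A (r * x)%R])%E.
  move=> mA muA; rewrite lt0e measure_ge0 andbT; apply/eqP => N0.
  have mrA : measurable [set x | A (r * x)].
    by apply: (@measurable_preimage _ _ _ _ (fun x : R => r * x)) => //;
      exact: measurable_funM.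
  have := lebesgue_measure_affine 0 r0 mA.
  rewrite (_ : _ @^-1` A = [set x | A (r * x)]); last first.
    by apply/seteqP; split => x /=; rewrite addr0.
  by rewrite (normal_prob_eq0 mrA N0) mule0 muA.
split.
- have /= := pos `]t, +oo[%classic (measurable_itv _).
  rewrite lebesgue_measure_itv/= ltry => /(_ erefl).
  rewrite (_ : [set x | _] = [set x | t < r * x]); first by apply.
  by apply/seteqP; split => x /=; rewrite in_itv/= andbT.
- have /= := pos `]-oo, t]%classic (measurable_itv _).
  rewrite lebesgue_measure_itv/= ltNyr => /(_ erefl).
  rewrite (_ : [set x | _] = [set x | r * x <= t]); first by apply.
  by apply/seteqP; split => x /=; rewrite in_itv.
Qed.

(** Coordinate p is overwritten by 0 instead of being removed, so the result is again an [l]-tuple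
    and can be tested on the same boxes. *)
Let erase (p : 'I_l) (z : l.-tuple R) : l.-tuple R :=
  [tuple if i == p then 0 else tnth z i | i < l].

Lemma standard_gaussian_erase (Z : T -> l.-tuple R) p (B : set R) D :
  measurable_fun setT Z -> standard_gaussian P Z ->
  measurable B -> measurable D ->
  P [set w | B (tnth (Z w) p) /\ D (erase p (Z w))] =
  (N B * P [set w | D (erase p (Z w))])%E.
Proof.
move=> mZ gZ mB mD.
have mZi i := measurable_tnth_comp i mZ.
have mE : measurable_fun setT (fun w => erase p (Z w)).
  apply: (@measurable_mktuple R _ _ l (fun i w =>
    if i == p then 0 else tnth (Z w) i)) => i.
  by case: (i == p).
have mBp : measurable [set w | B (tnth (Z w) p)].
  exact: measurable_preimage (mZi p) mB.
pose g : {mfun T >-> l.-tuple R} := HB.pack (fun w => erase p (Z w))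
  (isMeasurableFun.Build _ _ _ _ _ mE).
have mg : measurable_fun setT g by [].
pose m1 := measure_function_pushforward__canonical__measure_function_Measure
  (mrestr P mBp) mg.
pose K := NngNum (fine_ge0 (measure_ge0 N B)).
pose m2 : {measure set _ -> \bar R} := mscale K (distribution P g).
have K_E : (K%:num%:E)%E = N B by rewrite /= fineK// (@fin_num_measure _ _ _ N).
have m12 : m1 D = m2 D.
  apply: measure_eq_boxes => //.
    rewrite /m1/= /pushforward/= /mrestr/= preimage_setT setTI.
    exact: le_lt_trans (probability_le1 _ _) (ltry 1).
  move=> F mF.
  rewrite /m1 /m2/= /pushforward/= /mrestr/= /mscale/= K_E /distribution/=.
  rewrite /pushforward/=.
  (* The erased coordinate is 0, so a box whose p-th side misses 0 has empty preimage, and otherwise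
     that side imposes no condition. *)
  have [F0|F0] := pselect (F p 0); last first.
    rewrite (_ : _ `&` _ = set0); last first.
      apply/seteqP; split => // w [/= Fw _]; have := Fw p.
      by rewrite tnth_mktuple eqxx.
    rewrite (_ : _ @^-1` _ = set0) ?measure0 ?mule0//.
    apply/seteqP; split => // w /= Fw; have := Fw p.
    by rewrite tnth_mktuple eqxx.
  have E (A : set R) : measurable A ->
      P [set w | A (tnth (Z w) p) /\ box F (erase p (Z w))] =
      (N A * \prod_(i < l | i != p) N (F i))%E.
    move=> mA.
    pose F' i := if i == p then A else F i.
    rewrite (_ : [set w | _] = [set w | forall i, F' i (tnth (Z w) i)]).
      rewrite gZ; last by move=> i; rewrite /F'; case: ifP.
      rewrite (bigD1 p)//= /F' eqxx; congr (_ * _)%E.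
      by apply: eq_bigr => i /negbTE ->.
    apply/seteqP; split => w /=.
      move=> [Aw Fw] i; rewrite /F'; case: eqP => [->//|/eqP/negbTE ip].
      by have := Fw i; rewrite tnth_mktuple ip.
    move=> F'w; split; first by have := F'w p; rewrite /F' eqxx.
    move=> i; rewrite tnth_mktuple; case: eqP => [->//|/eqP/negbTE ip].
    by have := F'w i; rewrite /F' ip.
  rewrite (_ : _ `&` _ = [set w | B (tnth (Z w) p) /\ box F (erase p (Z w))]).
    rewrite E// (_ : _ @^-1` _ =
        [set w | setT (tnth (Z w) p) /\ box F (erase p (Z w))]).
      by rewrite E// [X in (_ * (X * _))%E](probability_setT N) mul1e.
    by apply/seteqP; split => w //= [].
  by apply/seteqP; split => w /= [].
move: m12; rewrite /m1 /m2/= /pushforward/= /mrestr/= /mscale/= K_E.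
rewrite /distribution/= /pushforward/= => <-; congr (P _).
by apply/seteqP; split => w /= [].
Qed.

(* A Givens rotation of the coordinates p and q moves the q-component of [a]
   into its p-component; once [a] is a multiple of the p-th unit vector, [g]
   does not see the p-th coordinate. *)
Lemma standard_gaussian_orthogonal_indep {d : measure_display}
    {V : measurableType d} (Z : T -> l.-tuple R) (a : 'I_l -> R) (p : 'I_l)
    (g : l.-tuple R -> V) :
  measurable_fun setT Z -> standard_gaussian P Z -> a p != 0 ->
  measurable_fun setT g -> (forall z t, g (addz z t a) = g z) ->
  exists2 r : R, r != 0 & forall B D, measurable B -> measurable D ->
    P [set w | B (dotz a (Z w)) /\ D (g (Z w))] =
    (N [set x | B (r * x)%R] * P [set w | D (g (Z w))])%E.
Proof.
(* Induction on the number of nonzero entries of [a] away from p; each rotation removes one of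
   them. *)
have [n] := ubnP #|[pred i | (i != p) && (a i != 0)]|.
elim: n => // n IH in Z a g *; rewrite ltnS => an mZ gZ ap mg ga.
have [[q /andP[qp aq]]|noq] := pselect (exists q, (q != p) && (a q != 0)); last first.
  have a0 i : i != p -> a i = 0.
    by move=> ip; apply/eqP/negPn/negP => ai; apply: noq; exists i; rewrite ip.
  have dotE z : dotz a z = a p * tnth z p.
    rewrite /dotz (bigD1 p)//= big1 ?addr0// => i ip.
    by rewrite a0// mul0r.
  have gE z : g z = g (erase p z).
    (* Here [a] is supported at p, and this translation along [a] brings the p-th coordinate to
       0. *)
    rewrite -(ga z (- (tnth z p / a p))); congr g.
    apply: eq_from_tnth => i; rewrite !tnth_mktuple.
    case: eqP => [->|/eqP ip]; last by rewrite (a0 i ip) mulr0 addr0.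
    by rewrite mulNr divfK// subrr.
  exists (a p) => // B D mB mD.
  have mBa : measurable [set x | B (a p * x)].
    by apply: (@measurable_preimage _ _ _ _ (fun x : R => a p * x)) => //;
      exact: measurable_funM.
  have := @standard_gaussian_erase Z p [set x | B (a p * x)] (g @^-1` D) mZ gZ mBa.
  move=> /(_ (measurable_preimage mg mD)) /=.
  rewrite (_ : [set w | D (g (erase p (Z w)))] = [set w | D (g (Z w))]).
    move=> <-; congr (P _); apply/seteqP; split => w /=; by rewrite dotE -gE.
  by apply/seteqP; split => w /=; rewrite -gE.
pose r := Num.sqrt (a p ^+ 2 + a q ^+ 2).
have r0 : 0 < r.
  rewrite sqrtr_gt0; apply: ltr_wpDr; first exact: sqr_ge0.
  by rewrite exprn_even_gt0.
have rr : r ^+ 2 = a p ^+ 2 + a q ^+ 2.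
  by rewrite sqr_sqrtr// addr_ge0// sqr_ge0.
pose c := a p / r; pose s := a q / r.
have c0 : c != 0 by rewrite mulf_neq0// invr_neq0// gt_eqF.
have cs : c ^+ 2 + s ^+ 2 = 1.
  by rewrite /c /s !expr_div_n -mulrDl -rr divff// expf_neq0// gt_eqF.
have cr : c * r = a p by rewrite divfK// gt_eqF.
have sr : s * r = a q by rewrite divfK// gt_eqF.
pose a' i := if i == p then r else if i == q then 0 else a i.
have pq : p != q by rewrite eq_sym.
pose Z' := givens p q c s \o Z.
(* Undoing the rotation inside [g'] gives g'(Z') = g(Z), and [g'] is invariant along the rotated
   vector [a']. *)
pose g' := g \o givens p q c (- s).
have givK z : givens p q c (- s) (givens p q c s z) = z.
  apply: eq_from_tnth => i; rewrite !tnth_mktuple !eqxx [q == p]eq_sym (negbTE pq).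
  case: eqP => [->|_].
    by rewrite -[RHS]mul1r -cs; ring.
  by case: eqP => [->|//]; rewrite -[RHS]mul1r -cs; ring.
have mZ' : measurable_fun setT Z'.
  exact: measurableT_comp (measurable_givens _ _ _ _) mZ.
have gZ' : standard_gaussian P Z' by exact: standard_gaussian_givens.
have mg' : measurable_fun setT g'.
  exact: measurableT_comp mg (measurable_givens _ _ _ _).
have ga' z t : g' (addz z t a') = g' z.
  rewrite /g' /= -[RHS](ga _ t); congr g; apply: eq_from_tnth => i.
  rewrite !tnth_mktuple /a' !eqxx [q == p]eq_sym (negbTE pq).
  case: eqP => [->|_]; first by rewrite -cr; ring.
  by case: eqP => [->|//]; rewrite -sr; ring.
have a'n : (#|[pred i | (i != p) && (a' i != 0%R)]| < n)%N.
  apply: leq_trans an; apply: proper_card; apply/properP; split.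
    apply/fintype.subsetP => i; rewrite !inE /a' => /andP[ip].
    by rewrite ip (negbTE ip); case: (i == q) => //; rewrite eqxx.
  exists q; first by rewrite inE qp aq.
  by rewrite inE /a' (negbTE qp) eqxx eqxx andbF.
have a'p : a' p != 0 by rewrite /a' eqxx gt_eqF.
have [r' r'0 H] := IH Z' a' g' a'n mZ' gZ' a'p mg' ga'.
exists r' => // B D mB mD.
have gE w : g' (Z' w) = g (Z w) by rewrite /g' /Z' /= givK.
have dE w : dotz a' (Z' w) = dotz a (Z w).
  rewrite /dotz (bigD1 p)//= (bigD1 q) 1?eq_sym//=.
  rewrite [RHS](bigD1 p)//= [in RHS](bigD1 q) 1?eq_sym//= !addrA; congr (_ + _).
    rewrite /a' /Z' /= !tnth_mktuple !eqxx [q == p]eq_sym (negbTE pq).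
    by rewrite -cr -sr; ring.
  apply: eq_bigr => i /andP[ip iq].
  by rewrite /a' /Z' /= !tnth_mktuple (negbTE ip) (negbTE iq).
rewrite -(_ : [set w | B (dotz a' (Z' w)) /\ D (g' (Z' w))] =
  [set w | B (dotz a (Z w)) /\ D (g (Z w))]); last first.
  by apply/seteqP; split => w /=; rewrite gE dE.
rewrite H//; congr (_ * P _)%E.
by apply/seteqP; split => w /=; rewrite gE.
Qed.

End gaussian_independence.

Lemma integrable_abse_le1 {R : realType} {d : measure_display}
    {T : measurableType d} (mu : {finite_measure set T -> \bar R}) (D : set T)
    (f : T -> \bar R) :
  measurable D -> measurable_fun D f -> (forall x, (`|f x| <= 1)%E) ->
  mu.-integrable D f.
Proof.
move=> mD mf f1; apply/integrableP; split => //.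
apply: (@le_lt_trans _ _ (\int[mu]_(x in D) cst 1 x)%E).
  by apply: ge0_le_integral => //; exact: measurableT_comp.
by rewrite integral_cst// mul1e -ge0_fin_numE// fin_num_measure.
Qed.

(** * Versions of conditional probabilities *)

Section conditional_probability.
Context {R : realType} {dT : measure_display} {T : measurableType dT}.
Context {d1 d2 d3 : measure_display}.
Context {V1 : measurableType d1} {V2 : measurableType d2}
  {V3 : measurableType d3}.
Variable P : probability T R.
Implicit Types (X : T -> V1) (Z : T -> V3).

Let g_sigma_algebra_preimage_comp Z (h : V3 -> R) : measurable_fun setT h ->
  forall B : set R, measurable B ->
    g_sigma_algebra_preimage Z ((fun w => h (Z w)) @^-1` B).
Proof.
move=> mh B mB; exists (h @^-1` B); first exact: measurable_preimage.
by rewrite setTI.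
Qed.

(** [Z] is frozen and the independent [X] integrated out. The defining identity on the event that
    [Z] lies in a set [C] is the integral formula for independent pairs, applied to the part of [S]
    above [C]. *)
Lemma is_cond_prob_independent X Z (S : set (V3 * V1)) :
  measurable_fun setT X -> measurable_fun setT Z -> independent_rv P X Z ->
  measurable S ->
  is_cond_prob P Z [set w | S (Z w, X w)]
    (fun w => fine (P [set u | S (Z w, X u)])).
Proof.
move=> mX mZ XZ mS; have mh : measurable_fun setT (fun z => fine (P [set u | S (z, X u)])).
  by apply: measurableT_comp => //; exact: measurable_prob_xsection.
have mSx w : measurable [set u | S (Z w, X u)].
  apply: (@measurable_preimage _ _ _ _ X (fun x => S (Z w, x))) => //.
  by have := measurable_xsection (Z w) mS; rewrite xsectionE.
have fS w : (fine (P [set u | S (Z w, X u)]))%:E = P [set u | S (Z w, X u)].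
  by rewrite fineK// fin_num_measure.
split.
- by move=> B mB; exact: (g_sigma_algebra_preimage_comp Z mh mB).
- have mfw : measurable_fun setT
      (fun w => (fine (P [set u | S (Z w, X u)]))%:E : \bar R).
    by apply/measurable_EFinP; exact: (measurableT_comp mh mZ).
  apply: integrable_abse_le1 => // w.
  by rewrite /comp fS gee0_abs//; exact: probability_le1.
- move=> _ [C mC <-]; rewrite setTI.
  under eq_integral do rewrite fS.
  pose S' := S `&` (fst @^-1` C).
  have mS' : measurable S'.
    by apply: measurableI => //; exact: measurable_preimage.
  have -> : P ([set w | S (Z w, X w)] `&` Z @^-1` C) =
      P [set w | S' (Z w, X w)] by [].
  rewrite (independent_integral_xsection mZ mX (independent_rvC XZ) mS').
  rewrite integral_mkcond; apply: eq_integral => w _.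
  rewrite patchE; case: ifPn; first rewrite inE/= => Cw; last first.
    rewrite notin_setE /= => Cw.
    rewrite (_ : _ @^-1` _ = set0) ?measure0//.
    by apply/seteqP; split => u //=; rewrite xsectionE /= => -[_ /Cw].
  by congr (P _); apply/seteqP; split => u; rewrite /= xsectionE//= => -[].
Qed.

(** The set where g < f belongs to sigma(Z), so both versions have the same integral over it; as f -
    g is positive there, it is null. *)
Let is_cond_prob_gt Z A (f g : T -> R) : measurable_fun setT Z ->
  is_cond_prob P Z A f -> is_cond_prob P Z A g ->
  P [set w | g w < f w] = 0%E.
Proof.
move=> mZ [mf fi fA] [mg gi gA].
pose TZ := g_sigma_algebra_preimageType Z.
have mf' : measurable_fun setT (f : TZ -> R).
  by move=> _ B mB; rewrite setTI; exact: mf.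
have mg' : measurable_fun setT (g : TZ -> R).
  by move=> _ B mB; rewrite setTI; exact: mg.
set D := [set w | _].
have sD : g_sigma_algebra_preimage Z D.
  have := measurable_preimage (measurable_funB mf' mg') (measurable_itv `]0, +oo[).
  rewrite (_ : _ @^-1` _ = D)//; apply/seteqP; split => w /=.
    by rewrite in_itv/= andbT subr_gt0.
  by rewrite in_itv/= andbT subr_gt0.
have mD : measurable D by case: sD => C mC <-; exact: mZ.
have fiD := integrableS measurableT mD (@subsetT _ D) fi.
have giD := integrableS measurableT mD (@subsetT _ D) gi.
have mfg : measurable_fun D (fun w => (f w - g w)%:E).
  by have := emeasurable_funB (measurable_int _ fiD) (measurable_int _ giD).
have : (\int[P]_(w in D) `|(f w - g w)%:E|)%E = 0%E.
  transitivity (\int[P]_(w in D) ((f w)%:E - (g w)%:E))%E.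
    apply: eq_integral => w; rewrite inE /D /= => gf.
    by rewrite ger0_norm ?EFinB// subr_ge0 ltW.
  by rewrite integralB// fA// -gA// subee// integrable_fin_num.
move/(ae_eq_integral_abs P mD mfg) => Dneg.
apply/(negligibleP P) => //; apply: negligibleS Dneg => w Dw /= /(_ Dw) [].
by move/eqP; rewrite subr_eq0 gt_eqF.
Qed.

Lemma is_cond_prob_unique Z A (f g : T -> R) : measurable_fun setT Z ->
  is_cond_prob P Z A f -> is_cond_prob P Z A g -> {ae P, forall w, f w = g w}.
Proof.
move=> mZ Af Ag.
have mD (u v : T -> R) : is_cond_prob P Z A u -> is_cond_prob P Z A v ->
    measurable [set w | u w < v w].
  move=> [_ ui _] [_ vi _].
  have mu : measurable_fun setT u by apply/measurable_EFinP; exact: measurable_int ui.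
  have mv : measurable_fun setT v by apply/measurable_EFinP; exact: measurable_int vi.
  have := measurable_preimage (measurable_funB mv mu) (measurable_itv `]0, +oo[).
  rewrite (_ : _ @^-1` _ = [set w | u w < v w])//.
  by apply/seteqP; split => w /=; rewrite in_itv/= andbT subr_gt0.
have fg := is_cond_prob_gt mZ Af Ag; have gf := is_cond_prob_gt mZ Ag Af.
apply: (@negligibleS _ _ _ _ ([set w | g w < f w] `|` [set w | f w < g w])).
  by move=> w /= /eqP; rewrite neq_lt => /orP[|]; [right|left].
by apply: negligibleU; apply/negligibleP => //; exact: mD.
Qed.

(** The hypothesis expresses that h(Z) is a version of P(Y in B2 | X, Z), tested on product events.
    A version of P(X in B1 | Z) is obtained as the density of the law of [Z] on the event X in B1
    with respect to the law of [Z], and its product with h(Z) serves as the joint version. *)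
Lemma cond_independent_kernel X (Y : T -> V2) Z :
  measurable_fun setT X -> measurable_fun setT Y -> measurable_fun setT Z ->
  (forall B2, measurable B2 -> exists h : V3 -> R,
    [/\ measurable_fun setT h, forall z, 0 <= h z <= 1 &
      forall B1 D, measurable B1 -> measurable D ->
      P (X @^-1` B1 `&` Y @^-1` B2 `&` Z @^-1` D) =
      (\int[P]_w (h (Z w) * \1_(X @^-1` B1 `&` Z @^-1` D) w)%:E)%E]) ->
  cond_independent P X Y Z.
Proof.
move=> mX mY mZ ker B1 B2 mB1 mB2.
have [h [mh h01 hE]] := ker B2 mB2.
set A := X @^-1` B1; have mA : measurable A by exact: measurable_preimage.
have mhZ : measurable_fun setT (fun w => h (Z w)) by exact: measurableT_comp mh mZ.
pose Z' : {mfun T >-> V3} := HB.pack Z (isMeasurableFun.Build _ _ _ _ Z mZ).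
pose nu : probability V3 R := distribution P Z'.
pose nuA0 := measure_function_pushforward__canonical__measure_function_Measure
  (mrestr P mA) mZ.
have nuAfin : fin_num_fun nuA0.
  move=> D mD; rewrite /nuA0/= /pushforward/= /mrestr/= fin_num_measure//.
  by apply: measurableI => //; exact: measurable_preimage.
pose nuA : {finite_measure set V3 -> \bar R} :=
  HB.pack (nuA0 : set V3 -> \bar R) (Measure.class nuA0) (Measure_isFinite.Build _ _ _ nuA0 nuAfin).
have nuAE D : nuA D = P (Z @^-1` D `&` A) by [].
have nuAnu : nuA `<< nu.
  apply/null_content_dominatesP => D mD nuD0; rewrite nuAE.
  apply/eqP; rewrite eq_le measure_ge0 andbT -[leRHS]nuD0.
  apply: le_measure; rewrite ?inE.
  - by apply: measurableI => //; exact: measurable_preimage.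
  - exact: measurable_preimage.
  - exact: subIsetl.
pose q := Radon_Nikodym (charge_of_finite_measure nuA) nu.
have qfin z : q z \is a fin_num by exact: Radon_Nikodym_fin_num.
have qi : nu.-integrable setT q by exact: Radon_Nikodym_integrable.
have qE D : measurable D -> (\int[nu]_(z in D) q z)%E = P (A `&` Z @^-1` D).
  by move=> mD; rewrite -Radon_Nikodym_integral// setIC.
pose fq z := fine (q z).
have fqE z : (fq z)%:E = q z by rewrite fineK.
have mq := measurable_int _ qi.
have mfq : measurable_fun setT fq by exact: measurableT_comp mq.
have qZi : P.-integrable setT (q \o Z).
  apply/integrableP; split; first exact: measurableT_comp mq mZ.
  rewrite -(@ge0_integral_pushforward _ _ _ _ _ _ mZ P setT (fun z => `|q z|)%E)//.
    by case/integrableP : qi.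
  exact: measurableT_comp.
have fqZi : P.-integrable setT (fun w => (fq (Z w))%:E).
  by rewrite (_ : (fun _ => _) = q \o Z)//; apply/funext => w; rewrite fqE.
have fqh_i : P.-integrable setT (fun w => (fq (Z w) * h (Z w))%:E).
  apply: le_integrable fqZi => //.
    apply/measurable_EFinP; apply: measurable_funM => //.
    exact: measurableT_comp mfq mZ.
  move=> w _; rewrite /= lee_fin normrM ler_piMr//.
  by have /andP[h0 h1] := h01 (Z w); rewrite ger0_norm.
exists (fun w => fq (Z w)), (fun w => h (Z w)), (fun w => fq (Z w) * h (Z w)).
split; last by apply: aeW => w.
- split => //.
    by move=> B mB; exact: (g_sigma_algebra_preimage_comp Z mfq mB).
  move=> _ [C mC <-]; rewrite setTI -qE//.
  rewrite (@integral_pushforward _ _ _ _ _ _ mZ P C q)//.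
    by apply: eq_integral => w _; rewrite fqE.
  by apply: integrableS qZi => //; exact: measurable_preimage.
- split.
  + by move=> B mB; exact: (g_sigma_algebra_preimage_comp Z mh mB).
  + apply: integrable_abse_le1 => // [|w]; first exact/measurable_EFinP.
    by have /andP[h0 h1] := h01 (Z w); rewrite lee_fin ger0_norm.
  + move=> _ [C mC <-]; rewrite setTI.
    have := hE setT C measurableT mC; rewrite preimage_setT !setTI => ->.
    rewrite integral_mkcond; apply: eq_integral => w _.
    by rewrite epatch_indic/= EFinM.
- split => //.
    move=> B mB.
    exact: (g_sigma_algebra_preimage_comp Z (measurable_funM mfq mh) mB).
  move=> _ [C mC <-]; rewrite setTI.
  have mZC : measurable (Z @^-1` C) by exact: measurable_preimage.
  have mhe : measurable_fun setT (fun z => (h z)%:E : \bar R).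
    exact/measurable_EFinP.
  have bounded_int (mu : {finite_measure set V3 -> \bar R}) :
      mu.-integrable C (fun z => (h z)%:E).
    apply: integrable_abse_le1 => // [|z]; first exact: measurable_funTS.
    by have /andP[h0 h1] := h01 z; rewrite lee_fin ger0_norm.
  (* The density [q] turns this integral into that of [h] against the law of [Z] restricted to [A],
     which the hypothesis evaluates. *)
  transitivity (\int[nu]_(z in C) ((h z)%:E * q z))%E.
    rewrite (@integral_pushforward _ _ _ _ _ _ mZ P C (fun z => (h z)%:E * q z)%E)//.
    - by apply: eq_integral => w _; rewrite /= -fqE -EFinM mulrC.
    - exact: emeasurable_funM.
    - rewrite (_ : _ \o _ = (fun w => (fq (Z w) * h (Z w))%:E)).
        exact: integrableS fqh_i.
      by apply/funext => w; rewrite /= -fqE -EFinM mulrC.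
  rewrite /q Radon_Nikodym_change_of_variables//.
  rewrite (@ge0_integral_pushforward _ _ _ _ _ _ mZ (mrestr P mA) C (fun z => (h z)%:E))//=.
    rewrite integral_mkcond (@finite_integral_density _ _ _ (mrestr P mA) P _
      (fun w => (\1_A w)%:E)) ?hE//.
    - apply: eq_integral => w _; rewrite epatch_indic/= -!EFinM indicI.
      by congr EFin; rewrite -mulrA; congr (_ * _); rewrite mulrC.
    - exact: integrable_indic.
    - by move=> D mD; rewrite integral_indic// /mrestr setIC.
    - apply: integrable_abse_le1 => // [|w].
        apply/(measurable_restrictT _ mZC)/measurable_funTS.
        exact: measurableT_comp mhe mZ.
      rewrite patchE; case: ifP => _; last by rewrite abse0.
      by have /andP[h0 h1] := h01 (Z w); rewrite lee_fin ger0_norm.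
  - exact: measurable_funTS.
  - by move=> z _; rewrite lee_fin; have /andP[] := h01 z.
Qed.

End conditional_probability.

(** * Cayley-Menger minors and regression weights *)

Section cayley_menger.
Context {R : realType} {d : nat}.
Variables (G : 'M[R]_d) (C : {set 'I_d}).

Let sel (t : 'I_(#|C| + 1)) : 'I_(d + 1) :=
  match fintype.split t with
  | inl c => lshift 1 (enum_val c)
  | inr o => rshift d o
  end.

(** The Cayley-Menger matrix of the principal submatrix of [G] on C. *)
Let M : 'M[R]_(#|C| + 1) := mxsub sel sel (CM G).

Let M_E t t' : M t t' = CM G (sel t) (sel t').
Proof. by rewrite mxE. Qed.

Let sel_l c : sel (lshift 1 c) = lshift 1 (enum_val c).
Proof. by rewrite /sel; have := unsplitK (inl c : 'I_#|C| + 'I_1) => /= ->. Qed.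

Let sel_r o : sel (rshift #|C| o) = rshift d o.
Proof. by rewrite /sel; have := unsplitK (inr o : 'I_#|C| + 'I_1) => /= ->. Qed.

Let CM_index_l i o : @CM_index d i C (lshift _ o) = lshift 1 i.
Proof.
by rewrite /CM_index; have := unsplitK (inl o : 'I_1 + 'I_(#|C| + 1)) => /= ->.
Qed.

Let CM_index_r i t : @CM_index d i C (rshift 1 t) = sel t.
Proof.
by rewrite /CM_index; have := unsplitK (inr t : 'I_1 + 'I_(#|C| + 1)) => /= ->.
Qed.

Let CM_ll a b : CM G (lshift 1 a) (lshift 1 b) = - (2^-1 * G a b).
Proof. by rewrite /CM block_mxEul !mxE. Qed.

Let CM_lr a o : CM G (lshift 1 a) (rshift d o) = 1.
Proof. by rewrite /CM block_mxEur !mxE. Qed.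

Let CM_rl a o : CM G (rshift d o) (lshift 1 a) = - 1.
Proof. by rewrite /CM block_mxEdl !mxE. Qed.

Let CM_rr o o' : CM G (rshift d o) (rshift d o') = 0.
Proof. by rewrite /CM block_mxEdr !mxE. Qed.

(** The C-part of [u], extended by 0 to all coordinates; sums over C can then be compared with the
    quadratic form of [G] on R^d. *)
Let spread (u : 'rV[R]_(#|C| + 1)) (a : 'I_d) : R :=
  \sum_(c < #|C|) u 0 (lshift 1 c) * (enum_val c == a)%:R.

Let sum_spread u (F : 'I_d -> R) :
  \sum_a spread u a * F a = \sum_(c < #|C|) u 0 (lshift 1 c) * F (enum_val c).
Proof.
rewrite /spread; under eq_bigr do rewrite mulr_suml.
rewrite exchange_big/=; apply: eq_bigr => c _.
rewrite (bigD1 (enum_val c))//= eqxx mulr1 big1 ?addr0// => a /negbTE.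
by rewrite eq_sym => ->; rewrite mulr0 mul0r.
Qed.

Let mulM_l (u : 'rV[R]_(#|C| + 1)) c : (u *m M) 0 (lshift 1 c) =
  - (2^-1 * \sum_a spread u a * G a (enum_val c)) - u 0 (rshift #|C| ord0).
Proof.
rewrite mxE big_split_ord/= big_ord1 M_E sel_r sel_l CM_rl mulrN1.
congr (_ - _); rewrite sum_spread mulr_sumr -sumrN; apply: eq_bigr => c' _.
by rewrite M_E !sel_l CM_ll; ring.
Qed.

Let mulM_r (u : 'rV[R]_(#|C| + 1)) : (u *m M) 0 (rshift #|C| ord0) =
  \sum_a spread u a.
Proof.
rewrite mxE big_split_ord/= big_ord1 M_E sel_r CM_rr mulr0 addr0.
transitivity (\sum_a spread u a * 1); last by apply: eq_bigr => a _; rewrite mulr1.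
by rewrite sum_spread; apply: eq_bigr => c _; rewrite M_E sel_l sel_r CM_lr.
Qed.

Hypothesis hG : HR_parameter G.
Hypothesis C0 : C != finset.set0.

(** For u in the left kernel, the C-part x has coordinate sum 0 and x^T G is constant on C, hence
    x^T G x = 0 and definiteness on the hyperplane gives x = 0. The column of any element of the
    non-empty C then forces the last entry to vanish. *)
Let M_unit : M \in unitmx.
Proof.
have [_ _ neg] := hG.
rewrite -row_free_unit; apply: inj_row_free => u uM.
have sum0 : \sum_a spread u a = 0 by rewrite -mulM_r uM mxE.
have col (c : 'I_#|C|) : \sum_a spread u a * G a (enum_val c) =
    - 2 * u 0 (rshift #|C| ord0).
  have := mulM_l u c; rewrite uM mxE => /esym/eqP; rewrite subr_eq0 => /eqP <-.
  by field.
pose x : 'cV[R]_d := \col_a spread u a.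
have x0 : x = 0.
  apply/eqP/negPn/negP => xn0.
  have hx : hyperplane x.
    apply/matrixP => o o'; rewrite !mxE -[RHS]sum0; apply: eq_bigr => a _.
    by rewrite !mxE mulr1.
  have := neg x hx xn0; rewrite mxE.
  rewrite (eq_bigr (fun b => spread u b * \sum_a spread u a * G a b)); last first.
    by move=> b _; rewrite !mxE mulrC; congr (_ * _); apply: eq_bigr => a _; rewrite !mxE.
  rewrite sum_spread; under eq_bigr do rewrite col.
  rewrite -mulr_suml (_ : \sum_(i < _) _ = 0) ?mul0r ?ltxx//.
  rewrite -[RHS]sum0; transitivity (\sum_a spread u a * 1).
    by rewrite sum_spread; apply: eq_bigr => c _; rewrite mulr1.
  by apply: eq_bigr => a _; rewrite mulr1.
have u_l (c : 'I_#|C|) : u 0 (lshift 1 c) = 0.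
  have /matrixP/(_ (enum_val c) ord0) := x0; rewrite !mxE /spread.
  rewrite (bigD1 c)//= eqxx mulr1 big1 ?addr0// => c' c'c.
  by rewrite (inj_eq enum_val_inj) (negbTE c'c) mulr0.
have u_r : u 0 (rshift #|C| ord0) = 0.
  have [c Cc] := set0Pn _ C0.
  have := col (enum_rank_in Cc c); rewrite sum_spread big1; last first.
    by move=> c' _; rewrite u_l mul0r.
  by move/esym/eqP; rewrite mulf_eq0 oppr_eq0 pnatr_eq0/= => /eqP.
apply/rowP => t; rewrite mxE -(splitK t).
by case: (fintype.split t) => [c|o] /=; rewrite ?u_l// (ord1 o) u_r.
Qed.

(* The weights [beta] solve the linear system whose matrix is the minor on C and
   d+1; the determinant is that minor [D] times a Schur complement. *)
Lemma det_CM_submx : exists2 D : R, D != 0 &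
  forall i, exists (beta : 'I_d -> R) (lambda : R),
    [/\ forall a, a \notin C -> beta a = 0,
        \sum_a beta a = 1,
        forall c, c \in C -> \sum_a ((a == i)%:R - beta a) * G a c = 2 * lambda &
        forall j, \det (CM_submx G i j C) =
          D * (lambda - 2^-1 * \sum_a ((a == i)%:R - beta a) * G a j)].
Proof.
exists (\det M); first by rewrite -unitfE -unitmxE.
move=> i.
have sum_e F : \sum_a ((a == i)%:R : R) * F a = F i.
  rewrite (bigD1 i)//= eqxx mul1r big1 ?addr0// => a /negbTE ->.
  by rewrite mul0r.
pose r : 'rV[R]_(#|C| + 1) := \row_t CM G (lshift 1 i) (sel t).
pose w := r *m invmx M.
(* The columns of this equation at C give the condition on [G], its last column says that the
   weights sum to 1, and [lambda] is the multiplier of that constraint. *)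
have wM : w *m M = r by rewrite mulmxKV.
pose beta := spread w.
pose lambda := w 0 (rshift #|C| ord0).
exists beta, lambda; split.
- move=> a aC; rewrite /beta /spread big1// => c _.
  case: eqP => [ca|]; last by rewrite mulr0.
  by move: aC; rewrite -ca enum_valP.
- by rewrite -mulM_r wM mxE sel_r CM_lr.
- move=> c cC; have := mulM_l w (enum_rank_in cC c).
  rewrite wM mxE sel_l CM_ll enum_rankK_in//.
  under [in X in _ -> X]eq_bigr do rewrite mulrBl.
  rewrite sumrB sum_e -/beta -/lambda; lra.
- move=> j.
  pose col : 'cV[R]_(#|C| + 1) := \col_t CM G (sel t) (lshift 1 j).
  pose al : 'M[R]_1 := (CM G (lshift 1 i) (lshift 1 j))%:M.
  have -> : CM_submx G i j C = block_mx al r col M.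
    rewrite -[LHS]submxK; congr block_mx; apply/matrixP => p q; rewrite !mxE.
    + by rewrite !CM_index_l (ord1 p) (ord1 q) eqxx mulr1n.
    + by rewrite CM_index_l CM_index_r.
    + by rewrite CM_index_l CM_index_r.
    + by rewrite !CM_index_r.
  (* Subtracting [w] times the lower rows clears the block to the right of the corner and leaves the
     Schur complement in the corner. *)
  have : block_mx 1%:M (- w) 0 1%:M *m block_mx al r col M =
      block_mx (al - w *m col) 0 col M.
    rewrite mulmx_block !mul1mx !mul0mx !add0r !mulNmx wM subrr.
    by [].
  move/(congr1 determinant); rewrite det_mulmx det_ublock !det1 !mul1r => ->.
  rewrite det_lblock mulrC; congr (_ * _).
  have alE : al 0 0 = - (2^-1 * G i j) by rewrite mxE eqxx mulr1n CM_ll.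
  have colE t : col t 0 = CM G (sel t) (lshift 1 j) by rewrite mxE.
  rewrite det_mx11 mxE alE mxE [(w *m col) _ _]mxE big_split_ord/= big_ord1.
  rewrite colE sel_r CM_rl.
  under [in RHS]eq_bigr do rewrite mulrBl.
  rewrite sumrB sum_e /beta sum_spread -/lambda.
  rewrite (_ : \sum_(c < _) _ =
    - (2^-1 * \sum_(c < #|C|) w 0 (lshift 1 c) * G (enum_val c) j)).
    by ring.
  rewrite mulr_sumr -sumrN; apply: eq_bigr => c _.
  by rewrite colE sel_l CM_ll; ring.
Qed.

End cayley_menger.

(** * Consequences for Gaussian and exponential variables *)

Section gaussian_corollaries.
Context {R : realType} {dT : measure_display} {T : measurableType dT}.
Variables (P : probability T R) (l : nat) (Z : T -> l.-tuple R).
Hypotheses (mZ : measurable_fun setT Z) (gZ : standard_gaussian P Z).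

Lemma standard_gaussian_indep {d : measure_display} {V : measurableType d}
    (a : 'I_l -> R) (g : l.-tuple R -> V) :
  measurable_fun setT g -> (forall z t, g (addz z t a) = g z) ->
  independent_rv P (fun w => dotz a (Z w)) (fun w => g (Z w)).
Proof.
move=> mg ga B D mB mD.
have [[p ap]|a0] := pselect (exists p, a p != 0).
  have [r r0 H] := standard_gaussian_orthogonal_indep mZ gZ ap mg ga.
  (* The instance with the full space for [D] identifies the normal factor as the probability that
     the linear form lies in [B]. *)
  have := H B D mB mD; have := H B setT mB measurableT.
  rewrite (_ : [set w | B _ /\ setT _] = (fun w => dotz a (Z w)) @^-1` B); last first.
    by apply/seteqP; split => w //= [].
  rewrite (_ : [set w | setT _] = setT)//.
  by rewrite [in X in (_ * X)%E](probability_setT P) mule1 => <- <-.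
have dot0 w : dotz a (Z w) = 0.
  rewrite /dotz big1// => i _; case: (eqVneq (a i) 0) => [->|ai].
    by rewrite mul0r.
  by case: a0; exists i.
have [B0|B0] := pselect (B 0).
  rewrite (_ : _ @^-1` B = setT).
    by rewrite setTI [in X in (X * _)%E](probability_setT P) mul1e.
  by apply/seteqP; split => w //= _; rewrite dot0.
rewrite (_ : _ @^-1` B = set0) ?set0I ?measure0 ?mul0e//.
by apply/seteqP; split => w //=; rewrite dot0.
Qed.

Lemma standard_gaussian_tail_gt0 (a : 'I_l -> R) p t : a p != 0 ->
  (0 < P [set w | (t < dotz a (Z w))%R])%E /\
  (0 < P [set w | (dotz a (Z w) <= t)%R])%E.
Proof.
move=> ap.
(* A constant [g] leaves only the law of the linear form, which is that of r times a standard normal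
   variable. *)
have [r r0 H] := standard_gaussian_orthogonal_indep mZ gZ ap
  (@measurable_cst _ _ _ R setT 0) (fun _ _ => erefl).
have tail (B : set R) : measurable B ->
    P [set w | B (dotz a (Z w))] = normal_prob 0 1 [set x | B (r * x)].
  move=> mB; have := H B setT mB measurableT.
  rewrite (_ : [set w | B _ /\ setT _] = [set w | B (dotz a (Z w))]); last first.
    by apply/seteqP; split => w //= [].
  rewrite (_ : [set w | setT _] = setT)//.
  by rewrite [in X in (_ * X)%E](probability_setT P) mule1.
have [pos1 pos2] := normal_prob_half_line_gt0 t r0.
have m1 : measurable [set x : R | t < x].
  rewrite (_ : [set x | t < x] = `]t, +oo[%classic); first exact: measurable_itv.
  by apply/seteqP; split => x /=; rewrite in_itv/= andbT.
have m2 : measurable [set x : R | x <= t].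
  rewrite (_ : [set x | x <= t] = `]-oo, t]%classic); first exact: measurable_itv.
  by apply/seteqP; split => x /=; rewrite in_itv.
by rewrite (tail _ m1) (tail _ m2).
Qed.

End gaussian_corollaries.

(** Lack of memory of the exponential law. The condition t <= e cuts off the negative part of [U],
    which carries no exponential mass on the right. *)
Lemma exponential_prob_shift {R : realType} (t : R) (U : set R) : 0 <= t ->
  measurable U ->
  exponential_prob 1 [set e | U (e - t) /\ t <= e] =
  ((expR (- t))%:E * exponential_prob 1 U)%E.
Proof.
move=> t0 mU; rewrite /exponential_prob.
have mp : measurable_fun setT (@exponential_pdf R 1).
  exact: measurable_exponential_pdf.
have p0 x : 0 <= @exponential_pdf R 1 x by exact: exponential_pdf_ge0.
have mU' : measurable [set e | U (e - t) /\ t <= e].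
  rewrite (_ : [set e | _] = (fun e => e - t) @^-1` U `&` `[t, +oo[%classic).
    apply: measurableI => //; apply: measurable_preimage => //.
    exact: measurable_funB.
  by apply/seteqP; split => e /=; rewrite in_itv/= andbT.
have mpr (A : set R) : measurable A ->
    measurable_fun setT ((fun x => (exponential_pdf 1 x)%:E : \bar R) \_ A).
  by move=> mA; apply/(measurable_restrictT _ mA)/measurable_funTS/measurable_EFinP.
rewrite integral_mkcond [in RHS]integral_mkcond.
rewrite (@ge0_integral_affine R 1 t) ?oner_neq0//; last 2 first.
- exact: (mpr _ mU').
- by move=> x; rewrite patchE; case: ifP => // _; rewrite lee_fin.
rewrite normr1 mul1e -ge0_integralZl//; last 2 first.
- exact: (mpr _ mU).
- by move=> x _; rewrite patchE; case: ifP => // _; rewrite lee_fin.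
apply: eq_integral => u _; rewrite !epatch_indic/= !indicE mul1r -!EFinM.
congr EFin; rewrite mulrA.
have [u0|u0] := ltP u 0.
  rewrite (lt0_exponential_pdf _ u0) mulr0 mul0r memNset ?mulr0//= => -[_].
  by rewrite lerDr leNgt u0.
rewrite !exponential_pdfE ?addr_ge0// !mul1r !mulN1r opprD expRD.
rewrite [expR (- u) * _]mulrC; congr (_ * (nat_of_bool _)%:R).
apply/idP/idP; rewrite !inE /= addrK; first by case.
by split => //; rewrite lerDr.
Qed.

Lemma measurable_addz {R : realType} {dT : measure_display}
    {T : measurableType dT} l (a : 'I_l -> R) (f : T -> l.-tuple R) (g : T -> R) :
  measurable_fun setT f -> measurable_fun setT g ->
  measurable_fun setT (fun w => addz (f w) (g w) a).
Proof.
move=> mf mg; apply: (@measurable_mktuple R _ _ l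
  (fun i w => tnth (f w) i + g w * a i)) => i.
apply: measurable_funD; last exact: measurable_funM.
exact: measurable_tnth_comp.
Qed.

Lemma measurable_dotz {R : realType} l (a : 'I_l -> R) :
  measurable_fun setT (dotz a).
Proof.
apply: measurable_sum => i; apply: measurable_funM => //.
exact: measurable_tnth.
Qed.

Lemma dotz_addz {R : realType} l (x v : 'I_l -> R) (y : l.-tuple R) t :
  dotz x (addz y t v) = dotz x y + t * \sum_i x i * v i.
Proof.
rewrite /dotz mulr_sumr -big_split/=; apply: eq_bigr => i _.
by rewrite tnth_mktuple; ring.
Qed.

Lemma addzC {R : realType} l (u v : 'I_l -> R) (y : l.-tuple R) s t :
  addz (addz y s u) t v = addz (addz y t v) s u.
Proof. by apply: eq_from_tnth => i; rewrite !tnth_mktuple addrAC. Qed.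

(** * Covariances of linear forms with coordinate sum 0 *)

Section direction.
Context {R : realType} {d : nat}.
Variables (G : 'M[R]_d).

(* For [x] with coordinate sum 0 this is Sigma^(k) x, extended by 0 at k. *)
Definition dirv (k : 'I_d) (x : 'I_d -> R) (b : 'I_d) : R :=
  2^-1 * (\sum_a x a * G a k - \sum_a x a * G a b).

Lemma dirv_id k x : dirv k x k = 0.
Proof. by rewrite /dirv subrr mulr0. Qed.

Hypothesis hG : HR_parameter G.

Lemma HR_Sigma_dirv k x b : \sum_a x a = 0 ->
  \sum_i x (lift k i) * HR_Sigma G k i b = dirv k x (lift k b).
Proof.
have [Gsym Gdiag _] := hG => sx.
have GC a a' : G a a' = G a' a by rewrite -[in LHS]Gsym mxE.
(* The term at a = k vanishes because G k k = 0, so the sum extends to all coordinates and the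
   condition on the sum of [x] can be applied. *)
pose f a := x a * (2^-1 * (G a k + G (lift k b) k - G a (lift k b))).
transitivity (\sum_a f a).
  rewrite (bigD1_ord k)//= {1}/f Gdiag (GC k) add0r subrr !mulr0 add0r.
  by apply: eq_bigr => i _; rewrite mxE.
transitivity (\sum_a (2^-1 * (x a * G a k) - 2^-1 * (x a * G a (lift k b)) +
    2^-1 * G (lift k b) k * x a)).
  by apply: eq_bigr => a _; rewrite /f; ring.
by rewrite big_split sumrB/= -!mulr_sumr sx mulr0 addr0 -mulrBr.
Qed.

(** When [x] also sums to 0, this is the covariance of x . Y and y . Y; the right-hand side shows
    that it is the same under all P( . | Y_k > 0). *)
Lemma sum_dirv k x y : \sum_a y a = 0 ->
  \sum_b y b * dirv k x b = - (2^-1 * \sum_b y b * \sum_a x a * G a b).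
Proof.
move=> sy; rewrite /dirv.
transitivity (\sum_b (y b * (2^-1 * \sum_a x a * G a k) -
    2^-1 * (y b * \sum_a x a * G a b))).
  by apply: eq_bigr => b _; ring.
by rewrite sumrB -mulr_suml sy mul0r sub0r -mulr_sumr.
Qed.

Lemma sum_dirvC k x y : \sum_a x a = 0 -> \sum_a y a = 0 ->
  \sum_b y b * dirv k x b = \sum_b x b * dirv k y b.
Proof.
have [Gsym _ _] := hG => sx sy; rewrite !sum_dirv//; congr (- (_ * _)).
under eq_bigr do rewrite mulr_sumr.
rewrite exchange_big/=; apply: eq_bigr => a _.
rewrite mulr_sumr; apply: eq_bigr => b _.
by rewrite -[in LHS]Gsym mxE; ring.
Qed.

Lemma sum_dirv_gt0 k x i : \sum_a x a = 0 -> x i != 0 ->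
  0 < \sum_b x b * dirv k x b.
Proof.
have [_ _ neg] := hG => sx xi; rewrite sum_dirv// oppr_gt0 pmulr_rlt0 ?invr_gt0//.
pose v : 'cV[R]_d := \col_a x a.
have := neg v; rewrite mxE.
rewrite (eq_bigr (fun b => x b * \sum_a x a * G a b)); last first.
  move=> b _; rewrite !mxE mulrC; congr (_ * _).
  by apply: eq_bigr => a _; rewrite !mxE.
apply.
  apply/matrixP => o o'; rewrite !mxE -[RHS]sx; apply: eq_bigr => a _.
  by rewrite !mxE mulr1.
by apply/eqP => /matrixP/(_ i ord0); rewrite !mxE => /eqP; apply/negP.
Qed.

End direction.

Section gaussian_vector.
Context {R : realType} {d l : nat}.
Variables (G : 'M[R]_d) (k : 'I_d) (A : 'M[R]_(d.-1, l)).

Definition gauss_vec (z : l.-tuple R) : d.-tuple R :=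
  [tuple if unlift k i is Some j
         then HR_mean G k j 0 + \sum_q A j q * tnth z q else 0 | i < d].

(** The vector A^T x, with the k-th entry of [x] left out: the coefficients of x . W in the standard
    Gaussian. *)
Definition gauss_coef (x : 'I_d -> R) (q : 'I_l) : R :=
  \sum_i x (lift k i) * A i q.

Lemma measurable_gauss_vec : measurable_fun setT gauss_vec.
Proof.
apply: (@measurable_mktuple R _ _ d (fun i z => if unlift k i is Some j
  then HR_mean G k j 0 + \sum_q A j q * tnth z q else 0)) => i.
case: (unlift k i) => [j|//]; apply: measurable_funD => //.
by apply: measurable_sum => q; apply: measurable_funM => //;
  exact: measurable_tnth.
Qed.

Hypothesis hG : HR_parameter G.
Hypothesis AA : A *m A^T = HR_Sigma G k.

Let gauss_coef_dirv x j : \sum_a x a = 0 ->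
  \sum_q A j q * gauss_coef x q = dirv G k x (lift k j).
Proof.
move=> sx; rewrite -HR_Sigma_dirv// -AA.
under eq_bigr do rewrite mulr_sumr.
rewrite exchange_big/=; apply: eq_bigr => i _.
rewrite mxE mulr_sumr; apply: eq_bigr => q _.
by rewrite mxE; ring.
Qed.

(** Moving [z] along A^T x moves its image along A A^T x = Sigma^(k) x. Invariance along
    [dirv G k x] thereby becomes invariance along the coefficient vector of the linear form. *)
Lemma gauss_vec_addz x z t : \sum_a x a = 0 ->
  gauss_vec (addz z t (gauss_coef x)) = addz (gauss_vec z) t (dirv G k x).
Proof.
move=> sx; apply: eq_from_tnth => i; rewrite !tnth_mktuple.
case: unliftP => [j ->|->]; last by rewrite dirv_id mulr0 addr0.
rewrite -gauss_coef_dirv// -addrA mulr_sumr -big_split/=; congr (_ + _).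
by apply: eq_bigr => q _; rewrite tnth_mktuple; ring.
Qed.

Lemma dotz_gauss_vec x z : dotz x (gauss_vec z) =
  \sum_i x (lift k i) * HR_mean G k i 0 + dotz (gauss_coef x) z.
Proof.
rewrite /dotz (bigD1_ord k)//= tnth_mktuple unlift_none mulr0 add0r.
have -> : \sum_q gauss_coef x q * tnth z q =
    \sum_i x (lift k i) * \sum_q A i q * tnth z q.
  under eq_bigr do rewrite mulr_suml.
  rewrite exchange_big/=; apply: eq_bigr => i _; rewrite mulr_sumr.
  by apply: eq_bigr => q _; rewrite mulrA.
rewrite -big_split/=; apply: eq_bigr => i _.
by rewrite tnth_mktuple liftK mulrDr.
Qed.

(** If A^T x vanished, so would Sigma^(k) x, and x . Y would have variance 0. *)
Lemma gauss_coef_neq0 x i : \sum_a x a = 0 -> x i != 0 ->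
  exists q, gauss_coef x q != 0.
Proof.
move=> sx xi; apply: contrapT => /forallNP coef0.
have := sum_dirv_gt0 hG k sx xi; rewrite big1 ?ltxx// => b _.
case: (unliftP k b) => [j ->|->]; last by rewrite dirv_id mulr0.
rewrite -gauss_coef_dirv// big1 ?mulr0// => q _.
by have /negP/negPn/eqP -> := coef0 q; rewrite mulr0.
Qed.

Lemma gaussian_law {dT : measure_display} {T : measurableType dT}
    (P : probability T R) (W : T -> d.-tuple R)
    (dT' : measure_display) (T' : measurableType dT') (P' : probability T' R)
    (Z : {RV P' >-> l.-tuple R}) : (forall w, tnth (W w) k = 0) ->
  eq_in_law P (fun w => [tuple tnth (W w) (lift k i) | i < d.-1]) P' (fun w =>
    [tuple (HR_mean G k + A *m \col_j tnth (Z w) j) i 0 | i < d.-1]) ->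
  eq_in_law P W P' (gauss_vec \o Z).
Proof.
move=> Wk WE S mS.
pose F (v : d.-1.-tuple R) : d.-tuple R :=
  [tuple if unlift k i is Some j then tnth v j else 0 | i < d].
have mF : measurable_fun setT F.
  apply: (@measurable_mktuple R _ _ d (fun i v =>
    if unlift k i is Some j then tnth v j else 0)) => i.
  by case: (unlift k i) => [j|//]; exact: measurable_tnth.
have FW w : F [tuple tnth (W w) (lift k i) | i < d.-1] = W w.
  apply: eq_from_tnth => i; rewrite !tnth_mktuple.
  by case: unliftP => [j ->|->]; rewrite ?tnth_mktuple.
have FZ w : F [tuple (HR_mean G k + A *m \col_j tnth (Z w) j) i 0 | i < d.-1] =
    gauss_vec (Z w).
  apply: eq_from_tnth => i; rewrite !tnth_mktuple.
  case: unliftP => [j _|//]; rewrite tnth_mktuple [LHS]mxE [X in _ + X]mxE.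
  by congr (_ + _); apply: eq_bigr => q _; rewrite [X in _ * X]mxE.
have := WE _ (measurable_preimage mF mS).
rewrite (_ : _ @^-1` (F @^-1` S) = W @^-1` S); last first.
  by apply/seteqP; split => w /=; rewrite FW.
move=> ->; congr (P' _).
by apply/seteqP; split => w /=; rewrite FZ.
Qed.

End gaussian_vector.

(** * The laws P( . | Y_k > 0): shifts and independence *)

Section huesler_reiss_independence.
Context {R : realType} {dT : measure_display} {T : measurableType dT}.
Variables (P : probability T R) (d : nat) (G : 'M[R]_d).
Hypothesis hG : HR_parameter G.
Variable Y : {RV P >-> d.-tuple R}.
Hypothesis hY : huesler_reiss Y G.
Local Notation one := (fun=> 1 : R).
Local Notation Pk := (exceed_prob P Y).
Local Notation pos k := [set w | 0 < tnth (Y w) k].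

Local Notation p k := (fine (P (pos k))).

Lemma probability_exceed_gt0 k : 0 < p k.
Proof.
have [_ pk _] := hY; rewrite fine_gt0// pk/=.
by apply: le_lt_trans (ltry 1); apply: probability_le1; exact: measurable_exceed.
Qed.

Lemma probability_exceedE k A : measurable A -> P (A `&` pos k) = ((p k)%:E * Pk k A)%E.
Proof.
move=> mA; have pk := probability_exceed_gt0 k.
have pE : P (pos k) = (p k)%:E.
  by rewrite fineK// fin_num_measure//; exact: measurable_exceed.
have normE (mu : {measure set T -> \bar R}) : mu setT = (p k)%:E ->
    mnormalize mu P A = (mu A * ((p k)^-1)%:E)%E.
  by move=> muT; rewrite /mnormalize muT eqe gt_eqF.
have -> : Pk k A = (mrestr P (measurable_exceed Y k) A * ((p k)^-1)%:E)%E.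
  by apply: normE; rewrite /= /mrestr setTI.
by rewrite /mrestr muleC -muleA -EFinM mulVf ?mule1// gt_eqF.
Qed.

Lemma exceed_law k : exists (d' : measure_display) (T' : measurableType d')
    (P' : probability T' R) (E : {RV P' >-> R}) (W : {RV P' >-> d.-tuple R}),
  [/\ exponential P' 1 E, independent_rv P' E W,
      forall w, tnth (W w) k = 0,
      gaussian P' (fun w => [tuple tnth (W w) (lift k i) | i < d.-1])
        (HR_mean G k) (HR_Sigma G k) &
      forall S, measurable S ->
        Pk k (Y @^-1` S) = P' [set w | S (addz (W w) (E w) one)]].
Proof.
have [_ _ /(_ k) [d' [T' [P' [E [W [eE EW Wk gW YE]]]]]]] := hY.
exists d', T', P', E, W; split => // S mS; rewrite YE//; congr (P' _).
apply/seteqP; split => w /=;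
  rewrite (_ : [tuple _ | i < d] = addz (W w) (E w) one)//;
  by apply: eq_from_tnth => i; rewrite !tnth_mktuple mulr1 addrC.
Qed.

Let mY : measurable_fun setT Y. Proof. by []. Qed.

Let maddzp : measurable_fun setT
  (fun q : R * d.-tuple R => addz q.2 q.1 one).
Proof. exact: measurable_addz. Qed.

(** Since W_k = 0, the coordinate Y_k is [E] itself. With W fixed, the event is a set of values of
    [E] shifted by t, and lack of memory yields the factor exp(-t). *)
Lemma exceed_shift k (t : R) S : 0 <= t -> measurable S ->
  Pk k [set w | S (addz (Y w) (- t) one) /\ t <= tnth (Y w) k] =
  ((expR (- t))%:E * Pk k (Y @^-1` S))%E.
Proof.
move=> t0 mS.
have [d' [T' [P' [E [W [eE EW Wk _ YE]]]]]] := exceed_law k.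
pose S1 := [set y : d.-tuple R | S (addz y (- t) one) /\ t <= tnth y k].
have mS1 : measurable S1.
  rewrite (_ : S1 = (fun y => addz y (- t) one) @^-1` S `&`
      (fun y => tnth y k) @^-1` `[t, +oo[%classic).
    apply: measurableI; apply: measurable_preimage => //.
      exact: measurable_addz.
    exact: measurable_tnth.
  by apply/seteqP; split => y /=; rewrite in_itv/= andbT.
have lawE S' : measurable S' -> Pk k (Y @^-1` S') =
    (\int[P']_w P' (E @^-1` [set e | S' (addz (W w) e one)]))%E.
  move=> mS'; rewrite YE//.
  have mS2 : measurable [set q : d.-tuple R * R | S' (addz q.1 q.2 one)].
    apply: (@measurable_preimage _ _ _ _
      (fun q : d.-tuple R * R => addz q.1 q.2 one)) => //.
    exact: measurable_addz.
  have := independent_integral_xsection (measurable_funP W) (measurable_funP E)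
    (independent_rvC EW) mS2.
  move=> /= ->; apply: eq_integral => w _; congr (P' _).
  by apply/seteqP; split => u /=; rewrite xsectionE.
rewrite (lawE S1 mS1) (lawE S mS).
rewrite -ge0_integralZl//; last first.
  have mS2 : measurable [set q : d.-tuple R * R | S (addz q.1 q.2 one)].
    apply: (@measurable_preimage _ _ _ _
      (fun q : d.-tuple R * R => addz q.1 q.2 one)) => //.
    exact: measurable_addz.
  exact: (measurableT_comp (measurable_prob_xsection P' (measurable_funP E) mS2)
    (measurable_funP W)).
apply: eq_integral => w _.
have mU : measurable [set e : R | S (addz (W w) e one)].
  apply: (@measurable_preimage _ _ _ _ (fun e : R => addz (W w) e one)) => //.
  exact: measurable_addz.
have mU1 : measurable [set e : R | S1 (addz (W w) e one)].
  apply: (@measurable_preimage _ _ _ _ (fun e : R => addz (W w) e one)) => //.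
  exact: measurable_addz.
rewrite !eE// -exponential_prob_shift//; congr (exponential_prob _ _).
have addE e : addz (addz (W w) e one) (- t) one = addz (W w) (e - t) one.
  by apply: eq_from_tnth => i; rewrite !tnth_mktuple; ring.
have tnthE e : tnth (addz (W w) e one) k = e.
  by rewrite tnth_mktuple Wk add0r mulr1.
by apply/seteqP; split => e; rewrite /S1 /= addE tnthE.
Qed.

(** For a fixed value of [E] this is a statement about the Gaussian W, because x . Y does not see
    [E]. The probability that x . W lies in [B] is then the same for all values of [E] and comes out
    of the integral over [E]. *)
Lemma exceed_independent {dV : measure_display} {V : measurableType dV}
    k (x : 'I_d -> R) (g : d.-tuple R -> V) :
  \sum_a x a = 0 -> measurable_fun setT g ->
  (forall y t, g (addz y t (dirv G k x)) = g y) ->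
  independent_rv (Pk k) (fun w => dotz x (Y w)) (fun w => g (Y w)).
Proof.
move=> sx mg gx B D mB mD.
have [d' [T' [P' [E [W [eE EW Wk gW YE]]]]]] := exceed_law k.
have [l [A [dZ [TZ [PZ [Z [AA gZ WE]]]]]]] := gW.
have WZ := gaussian_law Wk WE.
set mu0 := \sum_i x (lift k i) * HR_mean G k i 0.
pose a := gauss_coef k A x.
have mBx : measurable [set y : d.-tuple R | B (dotz x y)].
  exact: measurable_preimage (measurable_dotz x) mB.
have lawE S : measurable S -> Pk k (Y @^-1` S) =
    (\int[P']_w P' (W @^-1` [set v | S (addz v (E w) one)]))%E.
  move=> mS; rewrite YE//.
  have mS2 : measurable [set q : R * d.-tuple R | S (addz q.2 q.1 one)].
    exact: measurable_preimage maddzp mS.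
  have := independent_integral_xsection (measurable_funP E) (measurable_funP W)
    EW mS2.
  move=> /= ->; apply: eq_integral => w _; congr (P' _).
  by apply/seteqP; split => u /=; rewrite xsectionE.
have dotE v e : dotz x (addz v e one) = dotz x v.
  rewrite dotz_addz (_ : \sum_i _ = 0) ?mulr0 ?addr0// -[RHS]sx.
  by apply: eq_bigr => i _; rewrite mulr1.
have mge e : measurable_fun setT (fun v : d.-tuple R => g (addz v e one)).
  by apply: measurableT_comp mg _; exact: measurable_addz.
have indepW e D' : measurable D' ->
    P' (W @^-1` [set v | B (dotz x v) /\ D' (g (addz v e one))]) =
    (P' (W @^-1` [set v | B (dotz x v)]) *
     P' (W @^-1` [set v | D' (g (addz v e one))]))%E.
  move=> mD'.
  have mDe : measurable [set v | D' (g (addz v e one))].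
    exact: measurable_preimage (mge e) mD'.
  rewrite !WZ//; last exact: measurableI.
  pose ge z := g (addz (gauss_vec G k A z) e one).
  have mge' : measurable_fun setT ge.
    exact: measurableT_comp (mge e) (measurable_gauss_vec G k A).
  have geI z t : ge (addz z t a) = ge z.
    by rewrite /ge gauss_vec_addz// addzC gx.
  have mB' : measurable [set s : R | B (mu0 + s)].
    apply: (@measurable_preimage _ _ _ _ (fun s : R => mu0 + s)) => //.
    exact: measurable_funD.
  have := standard_gaussian_indep (measurable_funP Z) gZ mge' geI mB' mD'.
  rewrite (_ : _ @^-1` [set s | B (mu0 + s)] =
    (gauss_vec G k A \o Z) @^-1` [set v | B (dotz x v)])//.
  by apply/seteqP; split => u /=; rewrite dotz_gauss_vec.
have indepE D' : measurable D' ->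
    Pk k (Y @^-1` [set y | B (dotz x y) /\ D' (g y)]) =
    (P' (W @^-1` [set v | B (dotz x v)]) *
     Pk k (Y @^-1` [set y | D' (g y)]))%E.
  move=> mD'.
  have mgD' : measurable [set y | D' (g y)] by exact: measurable_preimage mg mD'.
  rewrite !lawE//; last exact: measurableI.
  rewrite -ge0_integralZl//.
    apply: eq_integral => w _; rewrite -indepW//; congr (P' _).
    by apply/seteqP; split => u /=; rewrite dotE.
  have mS2 : measurable [set q : R * d.-tuple R | D' (g (addz q.2 q.1 one))].
    exact: measurable_preimage maddzp mgD'.
  exact: (measurableT_comp (measurable_prob_xsection P' (measurable_funP W) mS2)
    (measurable_funP E)).
have := indepE D mD; have := indepE setT measurableT.
rewrite (_ : [set y | B _ /\ setT _] = [set y | B (dotz x y)]); last first.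
  by apply/seteqP; split => y //= [].
rewrite (_ : Y @^-1` [set y | setT _] = setT)//.
by rewrite [in X in (_ * X)%E](probability_setT (Pk k)) mule1 => <- <-.
Qed.

Lemma exceed_tail_gt0 k (x : 'I_d -> R) i t : \sum_a x a = 0 -> x i != 0 ->
  (0 < Pk k [set w | (t < dotz x (Y w))%R])%E /\
  (0 < Pk k [set w | (dotz x (Y w) <= t)%R])%E.
Proof.
move=> sx xi.
have [d' [T' [P' [E [W [eE EW Wk gW YE]]]]]] := exceed_law k.
have [l [A [dZ [TZ [PZ [Z [AA gZ WE]]]]]]] := gW.
have WZ := gaussian_law Wk WE.
have [q aq] := gauss_coef_neq0 hG AA sx xi.
set mu0 := \sum_i x (lift k i) * HR_mean G k i 0.
have dotE v e : dotz x (addz v e one) = dotz x v.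
  rewrite dotz_addz (_ : \sum_i _ = 0) ?mulr0 ?addr0// -[RHS]sx.
  by apply: eq_bigr => j _; rewrite mulr1.
have tail B : measurable B -> Pk k [set w | B (dotz x (Y w))] =
    PZ [set u | B (mu0 + dotz (gauss_coef k A x) (Z u))].
  move=> mB.
  have mBx : measurable [set y : d.-tuple R | B (dotz x y)].
    exact: measurable_preimage (measurable_dotz x) mB.
  have -> := YE _ mBx; under eq_set do rewrite /= dotE.
  have /= -> := WZ _ mBx; congr (PZ _).
  by apply/seteqP; split => u /=; rewrite dotz_gauss_vec.
have m1 : measurable [set s : R | t < s].
  rewrite (_ : [set s | t < s] = `]t, +oo[%classic); first exact: measurable_itv.
  by apply/seteqP; split => s /=; rewrite in_itv/= andbT.
have m2 : measurable [set s : R | s <= t].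
  rewrite (_ : [set s | s <= t] = `]-oo, t]%classic); first exact: measurable_itv.
  by apply/seteqP; split => s /=; rewrite in_itv.
rewrite (tail _ m1) (tail _ m2).
have [h1 h2] := standard_gaussian_tail_gt0 (measurable_funP Z) gZ (t - mu0) aq.
split.
  rewrite (_ : [set u | _] = [set u | t - mu0 < dotz (gauss_coef k A x) (Z u)])//.
  by apply/seteqP; split => u /=; rewrite ltrBlDl.
rewrite (_ : [set u | _] = [set u | dotz (gauss_coef k A x) (Z u) <= t - mu0])//.
by apply/seteqP; split => u /=; rewrite lerBrDl.
Qed.

End huesler_reiss_independence.

(** * Passage from one conditioning coordinate to another *)

Section exceed_transfer.
Context {R : realType} {dT : measure_display} {T : measurableType dT}.
Variables (P : probability T R) (d : nat) (G : 'M[R]_d).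
Hypothesis hG : HR_parameter G.
Variable Y : {RV P >-> d.-tuple R}.
Hypothesis hY : huesler_reiss Y G.
Local Notation one := (fun=> 1 : R).
Local Notation Pk := (exceed_prob P Y).
Local Notation pos k := [set w | 0 < tnth (Y w) k].
Local Notation p k := (fine (P (pos k))).

Let mY : measurable_fun setT Y. Proof. by []. Qed.

Let measurable_gt k (s : R) : measurable [set y : d.-tuple R | s < tnth y k].
Proof.
rewrite (_ : [set y | _] = (fun y => tnth y k) @^-1` `]s, +oo[%classic).
  by apply: measurable_preimage => //; exact: measurable_tnth.
by apply/seteqP; split => y /=; rewrite in_itv/= andbT.
Qed.

Let measurable_ge k (s : R) : measurable [set y : d.-tuple R | s <= tnth y k].
Proof.
rewrite (_ : [set y | _] = (fun y => tnth y k) @^-1` `[s, +oo[%classic).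
  by apply: measurable_preimage => //; exact: measurable_tnth.
by apply/seteqP; split => y /=; rewrite in_itv/= andbT.
Qed.

(* Homogeneity of the exponent measure: both sides are its mass on
   [S] intersected with [y_i > 0] and [y_k > - t], translated by [t]. *)
Lemma exceed_change i k (t : R) S : 0 <= t -> measurable S ->
  ((p i * expR (- t))%:E * Pk i [set w | S (Y w) /\ (- t < tnth (Y w) k)%R] =
   (p k)%:E * Pk k [set w | S (addz (Y w) (- t) one) /\
     (t <= tnth (Y w) i)%R /\ (0 < tnth (Y w) i)%R])%E.
Proof.
move=> t0 mS.
pose S1 := [set y : d.-tuple R | S y /\ - t < tnth y k].
have mS1 : measurable S1 by exact: (measurableI _ _ mS (measurable_gt k _)).
rewrite EFinM -muleA.
have := exceed_shift hY i t0 mS1; rewrite [in RHS]/S1/= => <-.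
have maz : measurable_fun setT (fun y : d.-tuple R => addz y (- t) one).
  exact: measurable_addz.
have mA : measurable [set y | S (addz y (- t) one)].
  exact: measurable_preimage maz mS.
have tnE w : (- t < tnth (addz (Y w) (- t) one) k) = (0 < tnth (Y w) k).
  by rewrite tnth_mktuple mulr1 ltrDr.
have mA1 : measurable [set w | S1 (addz (Y w) (- t) one) /\ t <= tnth (Y w) i].
  exact: (measurable_preimage mY (measurableI _ _
    (measurable_preimage maz mS1) (measurable_ge i t))).
have mA2 : measurable [set w | S (addz (Y w) (- t) one) /\
    t <= tnth (Y w) i /\ 0 < tnth (Y w) i].
  exact: (measurable_preimage mY (measurableI _ _ mA
    (measurableI _ _ (measurable_ge i t) (measurable_gt i 0)))).
rewrite -(probability_exceedE hY _ mA1) -(probability_exceedE hY _ mA2).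
congr (P _); apply/seteqP; split => w; rewrite /S1 /= tnE.
  by move=> [[[? ?] ?] ?].
by move=> [[? [? ?]] ?].
Qed.

(** On the event Y_k > -n, translation by n leads from P( . | Y_i > 0) to P( . | Y_k > 0), where
    independence is available; x . Y is unchanged by the translation. As n grows these events
    exhaust the space. *)
Lemma exceed_independent_transfer {dV : measure_display} {V : measurableType dV}
    i k (x : 'I_d -> R) (g : d.-tuple R -> V) :
  \sum_a x a = 0 -> measurable_fun setT g ->
  (forall y t, g (addz y t (dirv G k x)) = g y) -> dirv G k x i = 0 ->
  independent_rv (Pk i) (fun w => dotz x (Y w)) (fun w => g (Y w)).
Proof.
move=> sx mg gx xi B D mB mD.
have mBx : measurable [set y : d.-tuple R | B (dotz x y)].
  exact: measurable_preimage (measurable_dotz x) mB.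
(* This factor does not depend on n and passes unchanged through the limit; it is identified at the
   end by taking the full space for [D]. *)
pose K := Pk k [set w | B (dotz x (Y w))].
have step D' (n : nat) : measurable D' ->
    Pk i [set w | (B (dotz x (Y w)) /\ D' (g (Y w))) /\ - n%:R < tnth (Y w) k] =
    (K * Pk i [set w | D' (g (Y w)) /\ (- n%:R < tnth (Y w) k)%R])%E.
  move=> mD'.
  have mgD' : measurable [set y | D' (g y)] by exact: measurable_preimage mg mD'.
  pose a := p i * expR (- n%:R).
  have a0 : 0 < a by rewrite mulr_gt0 ?expR_gt0 ?(probability_exceed_gt0 hY).
  have aI (X : \bar R) : X = ((a^-1)%:E * (a%:E * X))%E.
    by rewrite muleA -EFinM mulVf ?mul1e// gt_eqF.
  rewrite [LHS]aI [X in (K * X)%E]aI.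
  have /= -> := @exceed_change i k n%:R [set y | B (dotz x y) /\ D' (g y)]
    (ler0n _ _) (measurableI _ _ mBx mgD').
  have /= -> := @exceed_change i k n%:R [set y | D' (g y)] (ler0n _ _) mgD'.
  rewrite [RHS]muleCA; congr (_ * _)%E; rewrite [RHS]muleCA; congr (_ * _)%E.
  (* Y_i is adjoined to [g] to express the translated conditioning event; invariance is kept since
     the direction vanishes at i. *)
  pose g' y := (g (addz y (- n%:R) one), tnth y i).
  have mg' : measurable_fun setT g'.
    apply: measurable_pair; last exact: measurable_tnth.
    by apply: measurableT_comp mg _; exact: measurable_addz.
  have gx' y t : g' (addz y t (dirv G k x)) = g' y.
    by rewrite /g' addzC gx tnth_mktuple xi mulr0 addr0.
  have mE : measurable (D' `*` [set s : R | n%:R <= s /\ 0 < s]).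
    apply: measurableX => //.
    rewrite (_ : [set s | _] = `[n%:R, +oo[%classic `&` `]0, +oo[%classic).
      exact: measurableI.
    by apply/seteqP; split => s /=; rewrite !in_itv/= !andbT.
  have /= := exceed_independent hG hY sx mg' gx' mB mE.
  rewrite /K => <-; congr (Pk k _); apply/seteqP; split => w /=.
    rewrite dotz_addz (_ : \sum_i _ = 0) ?mulr0 ?addr0; last first.
      by rewrite -[RHS]sx; apply: eq_bigr => j _; rewrite mulr1.
    by move=> [[]].
  rewrite dotz_addz (_ : \sum_i _ = 0) ?mulr0 ?addr0; last first.
    by rewrite -[RHS]sx; apply: eq_bigr => j _; rewrite mulr1.
  by move=> [? []].
have limE S : measurable S ->
    Pk i [set w | S (Y w) /\ - n%:R < tnth (Y w) k] @[n --> \oo] -->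
    Pk i [set w | S (Y w)].
  move=> mS.
  have -> : [set w | S (Y w)] = \bigcup_n [set w | S (Y w) /\ - n%:R < tnth (Y w) k].
    apply/seteqP; split => [w /= Sw|w [n _ []]//].
    exists (Num.truncn `|tnth (Y w) k|).+1 => //; split => //.
    rewrite ltrNl; apply: le_lt_trans (truncnS_gt _).
    by rewrite -normrN ler_norm.
  apply: nondecreasing_cvg_mu => [n||m n mn].
  - exact: (measurable_preimage mY (measurableI _ _ mS (measurable_gt k _))).
  - apply: bigcupT_measurable => n.
    exact: (measurable_preimage mY (measurableI _ _ mS (measurable_gt k _))).
  - apply/subsetPset => w /= [Sw mw]; split => //; apply: le_lt_trans mw.
    by rewrite lerN2 ler_nat.
have indepE D' : measurable D' ->
    Pk i [set w | B (dotz x (Y w)) /\ D' (g (Y w))] =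
    (K * Pk i [set w | D' (g (Y w))])%E.
  move=> mD'.
  have mgD' : measurable [set y | D' (g y)] by exact: measurable_preimage mg mD'.
  have lim1 := limE _ (measurableI _ _ mBx mgD').
  have lim2 := limE _ mgD'.
  apply: (cvg_unique _ lim1) => //=.
  under eq_cvg do rewrite step//.
  apply: cvgeZl lim2; rewrite fin_num_measure//.
  exact: (measurable_preimage mY mBx).
have := indepE D mD; have := indepE setT measurableT.
rewrite (_ : [set w | B _ /\ setT _] = [set w | B (dotz x (Y w))]); last first.
  by apply/seteqP; split => y //= [].
rewrite (_ : [set w | setT _] = setT)//.
by rewrite [in X in (_ * X)%E](probability_setT (Pk i)) mule1 => <- <-.
Qed.

End exceed_transfer.

Lemma cond_independentC {R : realType} {dT : measure_display}
    {T : measurableType dT} {d1 d2 d3 : measure_display}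
    {V1 : measurableType d1} {V2 : measurableType d2} {V3 : measurableType d3}
    (P : probability T R) (X1 : T -> V1) (X2 : T -> V2) (Z : T -> V3) :
  cond_independent P X1 X2 Z -> cond_independent P X2 X1 Z.
Proof.
move=> X12 B2 B1 mB2 mB1.
have [f1 [f2 [f12 [h1 h2 h12 f12E]]]] := X12 B1 B2 mB1 mB2.
exists f2, f1, f12; split => //; first by rewrite setIC.
by apply: filterS f12E => w ->; rewrite mulrC.
Qed.

(** * Dependence created by a monotone drift *)

Section drift.
Context {R : realType} {dT : measure_display} {T : measurableType dT}.
Variable (P : probability T R).

Let pr (A : set T) : R := fine (P A).

Let prE A : measurable A -> P A = (pr A)%:E.
Proof. by move=> mA; rewrite /pr fineK// fin_num_measure. Qed.

Let le_pr A B : measurable A -> measurable B -> A `<=` B -> pr A <= pr B.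
Proof.
by move=> mA mB AB; rewrite -lee_fin -!prE//; apply: le_measure; rewrite ?inE.
Qed.

Let prU A B : measurable A -> measurable B -> A `&` B = set0 ->
  pr (A `|` B) = pr A + pr B.
Proof.
move=> mA mB AB; apply: EFin_inj; rewrite EFinD -!prE//; last exact: measurableU.
by rewrite measureU.
Qed.

Let prC A : measurable A -> pr A + pr (~` A) = 1.
Proof.
move=> mA; rewrite -prU//; last by rewrite setICr.
  by rewrite setUv /pr (probability_setT P).
exact: measurableC.
Qed.

(* Given [U], the event [q < V + c * U] becomes more likely as [U] grows;
   independence would force its conditional probability to be constant in [U],
   hence all the mass of [V] to escape to infinity. *)
Lemma drift_not_independent (U V : T -> R) (c p q : R) :
  measurable_fun setT U -> measurable_fun setT V -> independent_rv P U V ->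
  0 < c -> (forall t, (0 < P [set w | (t < U w)%R])%E /\
                      (0 < P [set w | (U w <= t)%R])%E) ->
  P [set w | p < U w /\ q < V w + c * U w] <>
  (P [set w | (p < U w)%R] * P [set w | (q < V w + c * U w)%R])%E.
Proof.
move=> mU mV UV c0 tail PAB.
have mgt (s : R) : measurable [set x : R | s < x].
  rewrite (_ : [set x | s < x] = `]s, +oo[%classic); first exact: measurable_itv.
  by apply/seteqP; split => x /=; rewrite in_itv/= andbT.
have mle (s : R) : measurable [set x : R | x <= s].
  rewrite (_ : [set x | x <= s] = `]-oo, s]%classic); first exact: measurable_itv.
  by apply/seteqP; split => x /=; rewrite in_itv.
have mioc (s t : R) : measurable [set x : R | s < x /\ x <= t].
  exact: (measurableI _ _ (mgt s) (mle t)).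
have mUs B : measurable B -> measurable (U @^-1` B) by exact: measurable_preimage.
have mVs B : measurable B -> measurable (V @^-1` B) by exact: measurable_preimage.
have indep B1 B2 : measurable B1 -> measurable B2 ->
    pr (U @^-1` B1 `&` V @^-1` B2) = pr (U @^-1` B1) * pr (V @^-1` B2).
  move=> mB1 mB2; apply: EFin_inj; rewrite EFinM -!prE//; first exact: UV.
  - exact: mVs.
  - exact: mUs.
  - by apply: measurableI; [exact: mUs|exact: mVs].
pose A := [set w | p < U w]; pose A' := [set w | U w <= p].
pose B := [set w | q < V w + c * U w].
(* At U = p the event [B] reads V > r. So [E] implies [B] when U > p, and [B] implies [E] when U <=
   p. *)
pose r := q - c * p.
pose E := [set w | r < V w]; pose E' := [set w | V w <= r].
have mA : measurable A by exact: mUs (mgt p).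
have mA' : measurable A' by exact: mUs (mle p).
have mE : measurable E by exact: mVs (mgt r).
have mB : measurable B.
  apply: (@measurable_preimage _ _ _ _ (fun w => V w + c * U w)) (mgt q).
  by apply: measurable_funD => //; exact: measurable_funM.
have A'E : A' = ~` A by apply/seteqP; split => w; rewrite /A /A' /= leNgt => /negP.
have E'E : E' = ~` E by apply/seteqP; split => w; rewrite /E /E' /= leNgt => /negP.
have pA := prC mA; rewrite -A'E in pA.
have [A0 _] := tail p; have [_ A'0] := tail p.
rewrite -/A prE// lte_fin in A0; rewrite -/A' prE// lte_fin in A'0.
have AE : pr (A `&` E) = pr A * pr E by exact: (indep _ _ (mgt p) (mgt r)).
have A'Epr : pr (A' `&` E) = pr A' * pr E.
  exact: (indep _ _ (mle p) (mgt r)).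
have AB : pr (A `&` B) = pr A * pr B.
  by apply: EFin_inj; rewrite EFinM -!prE//; exact: measurableI.
have A'B : pr (A' `&` B) = pr A' * pr B.
  have : pr B = pr (A `&` B) + pr (A' `&` B).
    rewrite -prU; first by rewrite -setIUl A'E setUv setTI.
    - exact: measurableI.
    - exact: measurableI.
    - by rewrite setIACA A'E setICr set0I.
  rewrite AB => ?; nra.
have AEB : A `&` E `<=` A `&` B.
  move=> w [pU rV]; split => //; rewrite /B /=; rewrite /E /r /= in rV.
  rewrite /A /= in pU; nra.
have A'BE : A' `&` B `<=` A' `&` E.
  move=> w [pU qB]; split => //; rewrite /E /r /=; rewrite /B /= in qB.
  rewrite /A' /= in pU; nra.
(* [A] and its complement have positive probability and are independent of both [B] and [E];
   dividing by these probabilities turns the two inclusions into opposite inequalities. *)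
have BE : pr B = pr E.
  have := le_pr (measurableI _ _ mA mE) (measurableI _ _ mA mB) AEB.
  have := le_pr (measurableI _ _ mA' mB) (measurableI _ _ mA' mE) A'BE.
  rewrite AE AB A'Epr A'B !ler_pM2l// => BE EB.
  by apply/eqP; rewrite eq_le BE.
have null S : measurable S -> pr S = 0 -> P S = 0%E by move=> mS S0; rewrite prE// S0.
(* A product event that fits into F2 beside F1, when both have the same probability, is null; as its
   U-factor has positive probability, the V-factor is null. *)
have prod0 B1 B2 F1 F2 : measurable B1 -> measurable B2 ->
    measurable F1 -> measurable F2 -> pr F1 = pr F2 ->
    (0 < P (U @^-1` B1))%E ->
    (U @^-1` B1 `&` V @^-1` B2) `|` F1 `<=` F2 ->
    (U @^-1` B1 `&` V @^-1` B2) `&` F1 = set0 -> P (V @^-1` B2) = 0%E.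
  move=> mB1 mB2 mF1 mF2 F12 B10 sub dis.
  have mI : measurable (U @^-1` B1 `&` V @^-1` B2).
    by apply: measurableI; [exact: mUs|exact: mVs].
  have := le_pr (measurableU _ _ mI mF1) mF2 sub.
  rewrite prU// F12 gerDr indep//.
  have B10' : 0 < pr (U @^-1` B1) by rewrite -lte_fin -prE//; exact: mUs.
  rewrite pmulr_rle0// => V0; apply: null; first exact: mVs.
  by apply/eqP; rewrite eq_le V0 fine_ge0.
have E'0 : P E' = 0%E.
  have /(negligibleP P) : P.-negligible E'; last by apply; exact: mVs (mle r).
  have -> : E' = \bigcup_n (V @^-1` [set x | r - c * n%:R < x /\ x <= r]).
    apply/seteqP; split => [w /= Vr|w [n _ []]//].
    exists (Num.truncn ((r - V w) / c)).+1 => //; split => //.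
    have := truncnS_gt ((r - V w) / c); rewrite ltr_pdivrMr//; lra.
  apply: negligible_bigcup => n; apply/(negligibleP P); first exact: mVs.
  (* If U > p + n, then V > r - c n is enough for [B], so values of V just below r would make [B]
     likelier than [E] on [A]. *)
  apply: (prod0 [set x | p + n%:R < x] _ (A `&` E) (A `&` B)) => //.
  - exact: measurableI.
  - exact: measurableI.
  - by rewrite AE AB BE.
  - by have [] := tail (p + n%:R).
  - have n0 : 0 <= n%:R :> R by exact: ler0n.
    move=> w [[/= Un [Vn Vr]]|/AEB//]; rewrite /A /B /=; split; first by lra.
    rewrite /r in Vn; nra.
  - apply/seteqP; split => // w [[_ [_ /= Vr]] [_]]; rewrite /E /=.
    by rewrite ltNge Vr.
have E0 : P E = 0%E.
  have /(negligibleP P) : P.-negligible E; last by apply.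
  have -> : E = \bigcup_n (V @^-1` [set x | r < x /\ x <= r + c * n%:R]).
    apply/seteqP; split => [w /= Vr|w [n _ []]//].
    exists (Num.truncn ((V w - r) / c)).+1 => //; split => //.
    have := truncnS_gt ((V w - r) / c); rewrite ltr_pdivrMr//; lra.
  apply: negligible_bigcup => n; apply/(negligibleP P); first exact: mVs.
  (* If U <= p - n, then [B] fails for V up to r + c n; V thus has no mass on this side of r
     either. *)
  apply: (prod0 [set x | x <= p - n%:R] _ (A' `&` B) (A' `&` E)) => //.
  - exact: measurableI.
  - exact: measurableI.
  - by rewrite A'Epr A'B BE.
  - by have [] := tail (p - n%:R).
  - have n0 : 0 <= n%:R :> R by exact: ler0n.
    move=> w [[/= Un [Vr Vn]]|/A'BE//]; rewrite /A' /E /=; split => //; lra.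
  - have n0 : 0 <= n%:R :> R by exact: ler0n.
    apply/seteqP; split => // w [[/= Un [_ Vn]] [_]]; rewrite /B /=.
    rewrite /r in Vn; nra.
have := prC mE; rewrite -E'E /pr E0 E'0 /= addr0 => /eqP.
by rewrite eq_sym oner_eq0.
Qed.

End drift.

(** * Regression on Y_C and the resulting kernel *)

Section subvectors.
Context {R : realType} {d : nat}.

Lemma measurable_subvector (A : {set 'I_d}) :
  measurable_fun setT (@subvector R d A).
Proof.
apply: (@measurable_mktuple R _ _ #|A| (fun a y => tnth y (enum_val a))) => a.
exact: measurable_tnth.
Qed.

Lemma subvector_addz (A : {set 'I_d}) (y : d.-tuple R) t v :
  (forall a, a \in A -> v a = 0) -> subvector A (addz y t v) = subvector A y.
Proof.
move=> vA; apply: eq_from_tnth => a; rewrite !tnth_mktuple.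
by rewrite vA ?mulr0 ?addr0//; exact: enum_valP.
Qed.

Lemma subvector_set1 (i : 'I_d) (y : d.-tuple R) :
  subvector [set i] y = [tuple tnth y i | _ < #|[set i]%SET|].
Proof.
apply: eq_from_tnth => a; rewrite !tnth_mktuple.
by have := enum_valP a; rewrite inE => /eqP ->.
Qed.

Definition regression (C : {set 'I_d}) (beta : 'I_d -> R) (z : #|C|.-tuple R) : R :=
  \sum_c beta (enum_val c) * tnth z c.

Lemma measurable_regression C beta : measurable_fun setT (@regression C beta).
Proof.
apply: measurable_sum => c; apply: measurable_funM => //.
exact: measurable_tnth.
Qed.

Lemma tnth_residual (C : {set 'I_d}) (beta : 'I_d -> R) i y :
  (forall a, a \notin C -> beta a = 0) ->
  tnth y i = dotz (fun a => (a == i)%:R - beta a) y +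
             regression beta (subvector C y).
Proof.
move=> betaC; rewrite /dotz; under eq_bigr do rewrite mulrBl.
rewrite sumrB (bigD1 i)//= eqxx mul1r big1 ?addr0; last first.
  by move=> a /negbTE ->; rewrite mul0r.
rewrite (_ : regression _ _ = \sum_a beta a * tnth y a) ?subrK//.
rewrite [RHS](bigID (mem C))/= [X in _ + X]big1 ?addr0; last first.
  by move=> a aC; rewrite betaC// mul0r.
rewrite big_enum_val; apply: eq_bigr => c _.
by rewrite tnth_mktuple.
Qed.

End subvectors.

Section residual.
Context {R : realType} {dT : measure_display} {T : measurableType dT}.
Variables (Q : probability T R) (d : nat) (Y : {RV Q >-> d.-tuple R}).

(** Y_j is the residual plus a function of Y_C. The residual is independent of (Y_i, Y_C), so
    integrating it out gives a kernel for Y_j that depends on Y_C only. *)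
Lemma residual_cond_independent (i j : 'I_d) (C : {set 'I_d}) beta :
  (forall a, a \notin C -> beta a = 0) ->
  independent_rv Q (fun w => dotz (fun a => (a == j)%:R - beta a) (Y w))
    (fun w => (subvector [set i] (Y w), subvector C (Y w))) ->
  cond_independent Q (subvector [set i] \o Y) (subvector [set j] \o Y)
    (subvector C \o Y).
Proof.
move=> betaC indep.
have mY : measurable_fun setT Y by [].
pose V w := dotz (fun a => (a == j)%:R - beta a) (Y w).
have mV : measurable_fun setT V by exact: measurableT_comp (measurable_dotz _) mY.
have mS (A : {set 'I_d}) : measurable_fun setT (subvector A \o Y).
  exact: (measurableT_comp (@measurable_subvector R d A) mY).
apply: cond_independent_kernel; [exact: mS|exact: mS|exact: mS|move=> B2 mB2].
pose phi (s : R) : #|[set j]%SET|.-tuple R := [tuple s | _ < #|[set j]%SET|].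
have mphi : measurable_fun setT phi.
  exact: (@measurable_mktuple R _ _ _ (fun _ s => s)).
have mB : measurable [set s : R | B2 (phi s)] by exact: measurable_preimage mphi mB2.
pose S := [set q : #|C|.-tuple R * R | B2 (phi (q.2 + regression beta q.1))].
have mSS : measurable S.
  apply: (@measurable_preimage _ _ _ _
    (fun q : #|C|.-tuple R * R => q.2 + regression beta q.1)) mB.
  apply: measurable_funD => //.
  exact: measurableT_comp (measurable_regression _) measurable_fst.
have mVS z : measurable [set u | S (z, V u)].
  apply: (@measurable_preimage _ _ _ _ V (fun v => S (z, v))) => //.
  by have := measurable_xsection z mSS; rewrite xsectionE.
exists (fun z => fine (Q [set u | S (z, V u)])); split.
- by apply: measurableT_comp => //; exact: measurable_prob_xsection.
- by move=> z; rewrite fine_ge0//= -lee_fin fineK ?probability_le1// fin_num_measure.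
move=> B1 D mB1 mD.
pose S2 : set ((#|[set i]%SET|.-tuple R * #|C|.-tuple R) * R) :=
  [set q | (B1 q.1.1 /\ D q.1.2) /\ S (q.1.2, q.2)].
have mS2 : measurable S2.
  have m1 : measurable [set q : (#|[set i]%SET|.-tuple R * #|C|.-tuple R) * R |
      B1 q.1.1 /\ D q.1.2].
    have := measurableX (measurableX mB1 mD) (@measurableT _ R).
    rewrite (_ : _ `*` _ = [set q | B1 q.1.1 /\ D q.1.2])//.
    by apply/seteqP; split => q //= [].
  apply: (measurableI _ _ m1).
  apply: (@measurable_preimage _ _ _ _
    (fun q : (#|[set i]%SET|.-tuple R * #|C|.-tuple R) * R => (q.1.2, q.2))) => //.
  apply: measurable_pair => //.
  exact: measurableT_comp measurable_snd measurable_fst.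
have mXZ := measurable_pair (mS [set i]%SET) (mS C).
have := independent_integral_xsection mXZ mV (independent_rvC indep) mS2.
rewrite (_ : [set w | _] = (subvector [set i] \o Y) @^-1` B1 `&`
    (subvector [set j] \o Y) @^-1` B2 `&` (subvector C \o Y) @^-1` D); last first.
  apply/seteqP; split => w; rewrite /S2 /S /= (subvector_set1 j) -/phi.
    by rewrite -(tnth_residual j _ betaC) => -[[]].
  by rewrite -(tnth_residual j _ betaC) => -[[]].
move=> ->; apply: eq_integral => w _; rewrite indicE EFinM.
rewrite fineK; last by rewrite fin_num_measure.
case: (boolP (_ \in _)) => [|].
  rewrite inE => -[Bw Dw]; rewrite mule1; congr (Q _).
  by apply/seteqP; split => u /=; rewrite xsectionE /S2 /= => // -[].
rewrite notin_setE => nw; rewrite mule0 (_ : _ @^-1` _ = set0) ?measure0//.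
by apply/seteqP; split => u //=; rewrite xsectionE /S2 /= => -[/nw].
Qed.

End residual.

(** * Failure of conditional independence *)

Section conditional_dependence.
Context {R : realType} {dT : measure_display} {T : measurableType dT}.
Variables (Q : probability T R) (d : nat) (Y : {RV Q >-> d.-tuple R}).
Variables (i j : 'I_d) (C : {set 'I_d}).

(** As (U, V) is independent of Y_C, fixing Y_C keeps the law of (U, V) and turns the two events
    into p < U and q < V + c U, with thresholds determined by Y_C. *)
Lemma drift_cond_dependent (bi bj : 'I_d -> R) (s c : R)
    (U V : T -> R) (Z := fun w => subvector C (Y w)) :
  (forall w, s * tnth (Y w) i = U w + s * regression bi (Z w)) ->
  (forall w, tnth (Y w) j = V w + c * U w + regression bj (Z w)) ->
  measurable_fun setT U -> measurable_fun setT V ->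
  independent_rv Q U (fun w => (V w, Z w)) -> independent_rv Q V Z ->
  0 < c -> (forall t, (0 < Q [set w | (t < U w)%R])%E /\
                      (0 < Q [set w | (U w <= t)%R])%E) ->
  ~ cond_independent Q (subvector [set i] \o Y) (subvector [set j] \o Y)
      (subvector C \o Y).
Proof.
move=> Yi Yj mU mV UVZ VZ c0 tail CI.
have mY : measurable_fun setT Y by [].
have mZ : measurable_fun setT Z.
  exact: (measurableT_comp (@measurable_subvector R d C) mY).
have UV : independent_rv Q U V.
  move=> B1 B2 mB1 mB2.
  have := UVZ B1 (B2 `*` setT) mB1 (measurableX mB2 measurableT).
  rewrite (_ : (fun w => (V w, Z w)) @^-1` _ = V @^-1` B2)//.
  by apply/seteqP; split => w //= [].
have mVZ := measurable_pair mV mZ.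
have mUV := measurable_pair mU mV.
have UVindep : independent_rv Q (fun w => (U w, V w)) Z.
  move=> S D mS mD.
  pose S2 : set (R * (R * #|C|.-tuple R)) := [set q | S (q.1, q.2.1) /\ D q.2.2].
  have mS2 : measurable S2.
    apply: measurableI.
      apply: (@measurable_preimage _ _ _ _
        (fun q : R * (R * #|C|.-tuple R) => (q.1, q.2.1))) => //.
      apply: measurable_pair => //.
      exact: measurableT_comp measurable_fst measurable_snd.
    apply: (@measurable_preimage _ _ _ _
      (fun q : R * (R * #|C|.-tuple R) => q.2.2)) => //.
    exact: measurableT_comp measurable_snd measurable_snd.
  have /= -> := independent_integral_xsection mU mVZ UVZ mS2.
  have /= -> := independent_integral_xsection mU mV UV mS.
  rewrite -ge0_integralZr//; last first.
    have := measurable_prob_xsection Q mV mS.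
    move=> /measurableT_comp/(_ mU); apply: eq_measurable_fun => w _ /=.
    by congr (Q _); apply/seteqP; split => u /=; rewrite xsectionE.
  apply: eq_integral => w _.
  have mSw : measurable (xsection S (U w)) by exact: measurable_xsection.
  rewrite -VZ//; congr (Q _).
  by apply/seteqP; split => u /=; rewrite !xsectionE.
(* The index set of the tuple has one element. The factor [s] selects Y_i > 0 or Y_i < 0 according
   to the sign of the covariance. *)
pose B1 : set (#|[set i]%SET|.-tuple R) := [set t | forall a, 0 < s * tnth t a].
pose B2 : set (#|[set j]%SET|.-tuple R) := [set t | forall a, 0 < tnth t a].
have mgt0 (r : R) : measurable [set x : R | 0 < r * x].
  rewrite (_ : [set x | _] = (fun x => r * x) @^-1` `]0, +oo[%classic).
    apply: measurable_preimage => //; exact: measurable_funM.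
  by apply/seteqP; split => x /=; rewrite in_itv/= andbT.
have mB1 : measurable B1 by exact: (@measurable_box R _ (fun=> [set x | 0 < s * x])).
have mB2 : measurable B2.
  apply: (@measurable_box R _ (fun=> [set x | 0 < x])) => _.
  by have := mgt0 1; under eq_set do rewrite mul1r.
have [f1 [f2 [f12 [h1 h2 h12 f12E]]]] := CI B1 B2 mB1 mB2.
have in1 : (subvector [set i] \o Y) @^-1` B1 =
    [set w | 0 < U w + s * regression bi (Z w)].
  apply/seteqP; split => w /=; rewrite -Yi (subvector_set1 i) /B1 /=.
    have i0 : (0 < #|[set i]%SET|)%N by rewrite cards1.
    by move=> /(_ (Ordinal i0)); rewrite tnth_mktuple.
  by move=> Y0 a; rewrite tnth_mktuple.
have in2 : (subvector [set j] \o Y) @^-1` B2 =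
    [set w | 0 < V w + c * U w + regression bj (Z w)].
  apply/seteqP; split => w /=; rewrite -Yj (subvector_set1 j) /B2 /=.
    have j0 : (0 < #|[set j]%SET|)%N by rewrite cards1.
    by move=> /(_ (Ordinal j0)); rewrite tnth_mktuple.
  by move=> Y0 a; rewrite tnth_mktuple.
rewrite in1 in h1; rewrite in2 in h2; rewrite in1 in2 in h12.
pose S1 : set (#|C|.-tuple R * (R * R)) :=
  [set q | 0 < q.2.1 + s * regression bi q.1].
pose S2 : set (#|C|.-tuple R * (R * R)) :=
  [set q | 0 < q.2.2 + c * q.2.1 + regression bj q.1].
have mreg b : measurable_fun setT
    (fun q : #|C|.-tuple R * (R * R) => regression b q.1).
  exact: (measurableT_comp (@measurable_regression R d C b) measurable_fst).
have mf21 : measurable_fun setT (fun q : #|C|.-tuple R * (R * R) => q.2.1).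
  exact: measurableT_comp measurable_fst measurable_snd.
have mf22 : measurable_fun setT (fun q : #|C|.-tuple R * (R * R) => q.2.2).
  exact: measurableT_comp measurable_snd measurable_snd.
have mgt : measurable [set x : R | 0 < x].
  by have := mgt0 1; under eq_set do rewrite mul1r.
have mq1 : measurable_fun setT (fun q : #|C|.-tuple R * (R * R) =>
    q.2.1 + s * regression bi q.1).
  by apply: measurable_funD => //; exact: measurable_funM.
have mq2 : measurable_fun setT (fun q : #|C|.-tuple R * (R * R) =>
    q.2.2 + c * q.2.1 + regression bj q.1).
  by do 2 apply: measurable_funD => //; exact: measurable_funM.
have mS1 : measurable S1 := measurable_preimage mq1 mgt.
have mS2 : measurable S2 := measurable_preimage mq2 mgt.
have e1 := is_cond_prob_unique mZ h1
  (is_cond_prob_independent mUV mZ UVindep mS1).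
have e2 := is_cond_prob_unique mZ h2
  (is_cond_prob_independent mUV mZ UVindep mS2).
have e12 := is_cond_prob_unique mZ h12
  (is_cond_prob_independent mUV mZ UVindep (measurableI _ _ mS1 mS2)).
(* The four almost sure identities hold at a common point, since otherwise the whole space would be
   null. *)
have [w [w1 w2 w12 w3]] : exists w,
    [/\ f1 w = fine (Q [set u | S1 (Z w, (U u, V u))]),
        f2 w = fine (Q [set u | S2 (Z w, (U u, V u))]),
        f12 w = fine (Q [set u | (S1 `&` S2) (Z w, (U u, V u))]) &
        f12 w = f1 w * f2 w].
  apply: contrapT => /forallNP H.
  have : \forall w \ae Q, False.
    by near=> w; apply: (H w); split; near: w.
  rewrite /almost_everywhere /= => -[N [mN N0]] sub.
  have NT : N = setT by apply/seteqP; split => // w _; apply: sub => /=.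
  by move: N0; rewrite NT (probability_setT Q) => /eqP; rewrite onee_eq0.
pose p := - (s * regression bi (Z w)); pose q := - regression bj (Z w).
have mSx (S : set (#|C|.-tuple R * (R * R))) : measurable S ->
    measurable [set u | S (Z w, (U u, V u))].
  move=> mS; apply: (@measurable_preimage _ _ _ _ (fun u => (U u, V u))
    (fun r => S (Z w, r))) => //.
  by have := measurable_xsection (Z w) mS; rewrite xsectionE.
have mE1 := mSx _ mS1; have mE2 := mSx _ mS2.
have E1 : [set u | S1 (Z w, (U u, V u))] = [set u | p < U u].
  by apply/seteqP; split => u; rewrite /S1 /p /= => ?; lra.
have E2 : [set u | S2 (Z w, (U u, V u))] = [set u | q < V u + c * U u].
  by apply/seteqP; split => u; rewrite /S2 /q /= => ?; lra.
have E12 : [set u | (S1 `&` S2) (Z w, (U u, V u))] =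
    [set u | p < U u /\ q < V u + c * U u].
  by apply/seteqP; split => u; rewrite /S1 /S2 /p /q /= => -[? ?]; split; lra.
rewrite E1 in mE1; rewrite E2 in mE2.
apply: (drift_not_independent (p := p) (q := q) mU mV UV c0 tail).
move: w3; rewrite w1 w2 w12 E1 E2 E12 => w3.
rewrite -[LHS]fineK; last by rewrite fin_num_measure//; exact: measurableI.
by rewrite w3 EFinM !fineK// fin_num_measure.
Unshelve. all: by end_near.
Qed.

End conditional_dependence.

(** * The determinant as a covariance of residuals, and the equivalence *)

Theorem proposition3p3 (R : realType) (dT : measure_display)
    (T : measurableType dT) (P : probability T R)
    (d : nat) (hd : (2 <= d)%N)
    (G : 'M[R]_d) (hG : HR_parameter G)
    (Y : {RV P >-> d.-tuple R}) (hY : huesler_reiss Y G)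
    (i j : 'I_d) (hij : i != j)
    (C : {set 'I_d}) (hC0 : C != finset.set0)
    (hC : C \subset ~: [set i; j]%SET) :
  ext_cond_independent Y [set i]%SET [set j]%SET C
  <-> \det (CM_submx G i j C) = 0.
Proof.
have [D D0 weights] := det_CM_submx hG hC0.
have [bi [li [biC bi1 biG deti]]] := weights i.
have [bj [lj [bjC bj1 bjG _]]] := weights j.
have [k kC] := set0Pn _ hC0.
have notC a : (a == i) || (a == j) -> a \notin C.
  by move=> aij; apply/negP => /(fintype.subsetP hC); rewrite !inE aij.
have iC : i \notin C by apply: notC; rewrite eqxx.
pose xi a := (a == i)%:R - bi a; pose xj a := (a == j)%:R - bj a.
have sum_x a b : \sum_c b c = 1 -> \sum_c ((c == a)%:R - b c) = 0 :> R.
  move=> b1; rewrite sumrB b1 (bigD1 a)//= eqxx big1 ?addr0 ?subrr//.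
  by move=> c /negbTE ->.
have sxi : \sum_a xi a = 0 by exact: sum_x.
have sxj : \sum_a xj a = 0 by exact: sum_x.
(* As k lies in C, both sums in [dirv] equal 2 li: under P( . | Y_k > 0) the residual of Y_i is
   uncorrelated with Y_C. *)
have xiC c : c \in C -> dirv G k xi c = 0.
  by move=> cC; rewrite /dirv !biG// subrr mulr0.
have xjC c : c \in C -> dirv G k xj c = 0.
  by move=> cC; rewrite /dirv !bjG// subrr mulr0.
have det_dirv : \det (CM_submx G i j C) = D * dirv G k xi j.
  rewrite deti /dirv /xi (biG k kC); congr (_ * _).
  by rewrite mulrBr mulrA mulVf ?pnatr_eq0// mul1r.
have pair_dirv a b (v : 'I_d -> R) : (forall c, c \notin C -> b c = 0) ->
    (forall c, c \in C -> v c = 0) ->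
    \sum_c ((c == a)%:R - b c) * v c = v a.
  move=> bC vC; under eq_bigr do rewrite mulrBl.
  rewrite sumrB (bigD1 a)//= eqxx mul1r big1; last first.
    by move=> c /negbTE ->; rewrite mul0r.
  rewrite big1 ?subr0 ?addr0// => c _.
  by have [cC|cC] := boolP (c \in C); [rewrite vC ?mulr0|rewrite bC ?mul0r].
(* Both directions vanish on C, so pairing either one with the other residual leaves a single
   coordinate; symmetry of the covariance equates the two values. *)
have dirvC : dirv G k xj i = dirv G k xi j.
  have := sum_dirvC hG k sxi sxj; rewrite pair_dirv//.
  by rewrite pair_dirv.
split => [CI|/eqP]; last first.
  rewrite det_dirv mulf_eq0 (negbTE D0)/= => /eqP xij.
  have CIi k' : dirv G k xj k' = 0 ->
      cond_independent (exceed_prob P Y k')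
        (subvector [set i] \o Y) (subvector [set j] \o Y) (subvector C \o Y).
    move=> xjk'; apply: (residual_cond_independent bjC).
    apply: (exceed_independent_transfer (k := k) hG hY
      (g := fun y => (subvector [set i] y, subvector C y))) => //.
    - exact: (measurable_pair (@measurable_subvector R d _)
        (@measurable_subvector R d _)).
    - move=> y t; rewrite !subvector_addz// => a; rewrite inE => /eqP ->.
      by rewrite dirvC.
  have CIj k' : dirv G k xi k' = 0 ->
      cond_independent (exceed_prob P Y k')
        (subvector [set j] \o Y) (subvector [set i] \o Y) (subvector C \o Y).
    move=> xik'; apply: (residual_cond_independent biC).
    apply: (exceed_independent_transfer (k := k) hG hY
      (g := fun y => (subvector [set j] y, subvector C y))) => //.
    - exact: (measurable_pair (@measurable_subvector R d _)
        (@measurable_subvector R d _)).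
    - by move=> y t; rewrite !subvector_addz// => a; rewrite inE => /eqP ->.
  (* The direction of the residual of Y_j vanishes at i and on C. At j it is the direction of the
     residual of Y_i that vanishes, so the roles are exchanged there. *)
  move=> k'; rewrite !inE -orbA => /or3P[/eqP ->|/eqP ->|k'C].
  - by apply: CIi; rewrite dirvC.
  - exact/cond_independentC/CIj.
  - exact/CIi/xjC.
apply/eqP; rewrite det_dirv mulf_eq0 (negbTE D0)/=; apply/negPn/negP => r0.
have {}CI := CI k; rewrite !inE kC !orbT in CI; have {}CI := CI isT.
pose r := dirv G k xi j; pose v := \sum_b xi b * dirv G k xi b.
have xii : xi i != 0 by rewrite /xi eqxx biC// subr0 oner_neq0.
have v0 : 0 < v by exact: sum_dirv_gt0 xii.
pose s : R := Num.sg r.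
have ss : s * s = 1 by rewrite /s -expr2 sqr_sg r0.
(* The slope of the regression of the residual of Y_j on [s] times that of Y_i: their covariance is
   s r = |r|, and the variance is s^2 v = v. Hence x' . Y is uncorrelated with x . Y. *)
pose c := `|r| / v.
have c0 : 0 < c by rewrite divr_gt0// normr_gt0.
pose x a := s * xi a.
pose x' a := xj a - c * x a.
have sx : \sum_a x a = 0 by rewrite -mulr_sumr sxi mulr0.
have sx' : \sum_a x' a = 0 by rewrite sumrB -mulr_sumr sx sxj mulr0 subrr.
have sumx F : \sum_a x a * F a = s * \sum_a xi a * F a.
  by rewrite mulr_sumr; apply: eq_bigr => a _; rewrite /x mulrA.
have sumx' F : \sum_a x' a * F a = \sum_a xj a * F a - c * \sum_a x a * F a.
  rewrite mulr_sumr -sumrB; apply: eq_bigr => a _.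
  by rewrite /x'; ring.
have dirvx b : dirv G k x b = s * dirv G k xi b.
  by rewrite /dirv !sumx; ring.
have dirvx' b : dirv G k x' b = dirv G k xj b - c * dirv G k x b.
  by rewrite /dirv !sumx'; ring.
have covx : \sum_b x' b * dirv G k x b = 0.
  under eq_bigr do rewrite dirvx mulrCA.
  rewrite -mulr_sumr sumx' sumx pair_dirv// -/r -/v.
  transitivity (s * r - (s * s) * (c * v)); first by ring.
  by rewrite ss mul1r divfK ?gt_eqF// -normrEsg subrr.
have dotx y : dotz x y = s * dotz xi y.
  exact: sumx.
have dotx' y : dotz x' y = dotz xj y - c * dotz x y.
  exact: sumx'.
have mY : measurable_fun setT Y by [].
have mdot z : measurable_fun setT (fun w => dotz z (Y w)).
  exact: measurableT_comp (measurable_dotz z) mY.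
have xCx a : a \in C -> dirv G k x a = 0 by move=> aC; rewrite dirvx xiC// mulr0.
apply: (@drift_cond_dependent _ _ _ (exceed_prob P Y k) d Y i j C bi bj s c
  (fun w => dotz x (Y w)) (fun w => dotz x' (Y w))) CI => //.
- by move=> w; rewrite (tnth_residual i _ biC) mulrDr dotx.
- by move=> w; rewrite (tnth_residual j _ bjC) dotx' subrK.
- apply: (exceed_independent hG hY (g := fun y => (dotz x' y, subvector C y))) => //.
    apply: measurable_pair; first exact: measurable_dotz.
    exact: measurable_subvector.
  by move=> y t; rewrite dotz_addz covx mulr0 addr0 subvector_addz.
- apply: (exceed_independent hG hY (g := subvector C)) => //.
    exact: measurable_subvector.
  move=> y t; apply: subvector_addz => a aC.
  by rewrite dirvx' xjC// xCx// mulr0 subrr.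
- move=> t; apply: (@exceed_tail_gt0 _ _ _ P d G hG Y hY k x i t sx).
  by rewrite /x mulf_neq0// sgr_eq0.
Qed.
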